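(* There exist a complete simple theory $T$ of $SU$-rank $1$ and a formula $\phi(x,b)$ (with parameters $b$ from the monster model $\bar M$ of $T$) such that $\phi(x,b)$ does not fork over $\emptyset$, but $\mu(\phi(x,b))=0$ for every $\mathrm{Aut}(\bar M)$-invariant global Keisler measure $\mu(x)$.
   Context: Work in a sufficiently saturated model $\bar M$ of a complete theory $T$. A formula $\phi(x,b)$ divides over a set $A$ if there is an $A$-indiscernible sequence $(b_i)_{i<\omega}$ with $b_0=b$ such that $\{\phi(x,b_i):i<\omega\}$ is inconsistent; it forks over $A$ if it implies a finite disjunction of formulas each of which divides over $A$. A partial type divides/forks over $A$ if some formula in it does. $T$ is simple if for every complete type $p\in S(B)$ there is $A\subseteq B$ with $|A|\le|T|$ such that $p$ does not divide over $A$. $SU$-rank $1$ means every complete non-algebraic $1$-type has only algebraic forking extensions. A global Keisler measure $\mu(x)$ is a finitely additive probability measure on the Boolean algebra of subsets of the $x$-sort of $\bar M$ definable with parameters from $\bar M$; it is $\mathrm{Aut}(\bar M)$-invariant if $\mu(\sigma(D))=\mu(D)$ for all definable $D$ and automorphisms $\sigma$. *)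

(* Defs.v *)
From HB Require Import structures.
From mathcomp Require Import all_boot all_order all_algebra.
From mathcomp Require Import all_classical all_reals.

Set Implicit Arguments.
Unset Strict Implicit.
Unset Printing Implicit Defensive.

Import Order.TTheory GRing.Theory Num.Theory.

Local Open Scope classical_set_scope.
Local Open Scope card_scope.
Local Open Scope ring_scope.

Record language := Language {
  fun_sym : Type;
  fun_ar : fun_sym -> nat;
  rel_sym : Type;
  rel_ar : rel_sym -> nat
}.

(* [formula L X] is the type of L-formulas whose free variables are taken from
   [X]; a quantifier binds the variable [None]. A formula phi(x, y) with
   |x| = n and |y| = m is an element of [formula L ('I_n + 'I_m)]. *)
Inductive term (L : language) (X : Type) : Type :=
| Var of X
| App (f : fun_sym L) of ('I_(fun_ar f) -> term L X).

Inductive formula (L : language) (X : Type) : Type :=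
| Fal
| Eq of term L X & term L X
| Rel (r : rel_sym L) of ('I_(rel_ar r) -> term L X)
| Imp of formula L X & formula L X
| All of formula L (option X).

Arguments Var {L X}.
Arguments App {L X}.
Arguments Fal {L X}.
Arguments Eq {L X}.
Arguments Rel {L X}.
Arguments Imp {L X}.
Arguments All {L X}.

Definition Neg L (X : Type) (phi : formula L X) : formula L X := Imp phi Fal.

Record structure (L : language) := Structure {
  carrier :> Type;
  carrier_inhabited : inhabited carrier;
  fun_interp : forall f : fun_sym L, ('I_(fun_ar f) -> carrier) -> carrier;
  rel_interp : forall r : rel_sym L, ('I_(rel_ar r) -> carrier) -> Prop
}.

Section Semantics.
Variables (L : language) (M : structure L).

Fixpoint eval (X : Type) (v : X -> M) (t : term L X) : M :=
  match t with
  | Var x => v x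
  | App f args => fun_interp (fun i => eval v (args i))
  end.

Fixpoint sat (X : Type) (phi : formula L X) (v : X -> M) : Prop :=
  match phi with
  | Fal => False
  | Eq t u => eval v t = eval v u
  | Rel r args => rel_interp (fun i => eval v (args i))
  | Imp phi psi => sat phi v -> sat psi v
  | All phi => forall a : M, sat phi (fun x => oapp v a x)
  end.

Definition automorphism (s : M -> M) : Prop :=
  [/\ bijective s,
      forall (f : fun_sym L) args, s (fun_interp (f := f) args) =
        fun_interp (f := f) (fun i => s (args i))
    & forall (r : rel_sym L) args, rel_interp (r := r) args <->
        rel_interp (r := r) (fun i => s (args i))].

Definition elementary_on (A : set M) (f : M -> M) : Prop :=
  forall (k : nat) (psi : formula L 'I_k) (a : 'I_k -> M),
    (forall i, A (a i)) -> (sat psi a <-> sat psi (fun i => f (a i))).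

(* A formula phi(x, b) with |x| = n and parameters b from M. *)
Record pformula (n : nat) := PFormula {
  par_len : nat;
  fml : formula L ('I_n + 'I_par_len);
  par : 'I_par_len -> M
}.

Arguments par {n}.

Definition cat_val n m (a : 'I_n -> M) (b : 'I_m -> M) (z : 'I_n + 'I_m) : M :=
  match z with inl i => a i | inr j => b j end.

Definition psat n (phi : pformula n) (a : 'I_n -> M) : Prop :=
  sat (fml phi) (cat_val a (par phi)).

Definition solutions n (phi : pformula n) : set ('I_n -> M) :=
  [set a | psat phi a].

Definition pneg n (phi : pformula n) : pformula n :=
  PFormula (Neg (fml phi)) (par phi).

Definition over n (B : set M) (phi : pformula n) : Prop :=
  forall j, B (par phi j).

(* Consistency with the elementary diagram of M, by compactness. *)
Definition consistent n (p : set (pformula n)) : Prop :=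
  forall (N : nat) (s : 'I_N -> pformula n), (forall i, p (s i)) ->
    exists a, forall i, psat (s i) a.

(* p is a complete n-type over B. *)
Definition complete_type n (B : set M) (p : set (pformula n)) : Prop :=
  [/\ p `<=` over B, consistent p
    & forall phi, over B phi -> p phi \/ p (pneg phi)].

Definition realizes n (a : 'I_n -> M) (p : set (pformula n)) : Prop :=
  forall phi, p phi -> psat phi a.

Definition algebraic_type n (p : set (pformula n)) : Prop :=
  exists2 phi, p phi & finite_set (solutions phi).

Definition seq_val k m l (b : nat -> 'I_m -> M) (f : 'I_k -> nat)
    (c : 'I_l -> M) (z : 'I_k * 'I_m + 'I_l) : M :=
  match z with inl ij => b (f ij.1) ij.2 | inr j => c j end.

Definition indiscernible m (A : set M) (b : nat -> 'I_m -> M) : Prop :=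
  forall (k l : nat) (psi : formula L ('I_k * 'I_m + 'I_l)) (c : 'I_l -> M)
         (f g : 'I_k -> nat),
    (forall j, A (c j)) ->
    {homo f : i j / (i < j)%N} -> {homo g : i j / (i < j)%N} ->
    (sat psi (seq_val b f c) <-> sat psi (seq_val b g c)).

Definition divides n (A : set M) (phi : pformula n) : Prop :=
  exists b : nat -> 'I_(par_len phi) -> M,
    [/\ indiscernible A b, b 0%N = par phi
      & ~ consistent [set psi | exists i, psi = PFormula (fml phi) (b i)]].

Definition forks n (A : set M) (phi : pformula n) : Prop :=
  exists (N : nat) (psi : 'I_N -> pformula n),
    (forall a, psat phi a -> exists i, psat (psi i) a) /\
    (forall i, divides A (psi i)).

Definition type_divides n (A : set M) (p : set (pformula n)) : Prop :=
  exists2 phi, p phi & divides A phi.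

Definition type_forks n (A : set M) (p : set (pformula n)) : Prop :=
  exists2 phi, p phi & forks A phi.

Definition definable n (D : set ('I_n -> M)) : Prop :=
  exists phi : pformula n, D = solutions phi.

(* A Keisler measure is a function on the definable subsets of M^n; only the
   values of [mu] on those sets are constrained or used. *)
Definition keisler_measure (R : realType) n (mu : set ('I_n -> M) -> R) : Prop :=
  [/\ forall D, definable D -> 0 <= mu D,
      mu [set: 'I_n -> M] = 1
    & forall D E, definable D -> definable E -> D `&` E = set0 ->
        mu (D `|` E) = mu D + mu E].

Definition aut_invariant (R : realType) n (mu : set ('I_n -> M) -> R) : Prop :=
  forall (s : M -> M) (D : set ('I_n -> M)), automorphism s -> definable D ->
    mu [set (fun i => s (a i)) | a in D] = mu D.

(* M is kappa^+-saturated and strongly kappa^+-homogeneous, kappa = |K|. *)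
Definition saturated (K : Type) : Prop :=
  forall (n : nat) (B : set M) (p : set (pformula n)),
    B #<= [set: K] -> complete_type B p -> exists a, realizes a p.

Definition strongly_homogeneous (K : Type) : Prop :=
  forall (A : set M) (f : M -> M),
    A #<= [set: K] -> elementary_on A f ->
    exists2 s, automorphism s & forall a, A a -> s a = f a.

End Semantics.

Definition sentence (L : language) := formula L void.

Definition theory (L : language) := set (sentence L).

Definition holds L (M : structure L) (phi : sentence L) : Prop :=
  sat phi (fun x : void => match x return M with end).

Definition models L (M : structure L) (T : theory L) : Prop := T `<=` holds M.

Definition entails L (T : theory L) (phi : sentence L) : Prop :=
  forall M : structure L, models M T -> holds M phi.

Definition complete_theory L (T : theory L) : Prop :=
  (exists M : structure L, models M T) /\
  (forall phi, entails T phi \/ entails T (Neg phi)).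

(* |T| = |L| + aleph_0 is the cardinality of the set of L-formulas in the
   variables v_0, v_1, ... *)
Definition card_le_theory L (X : Type) (A : set X) : Prop :=
  A #<= [set: formula L nat].

(* The subsets of M of cardinality at most |mon_card| are the small ones; the
   bound 2^|T| <= |mon_card| is ``sufficiently'' in ``sufficiently
   saturated'': in particular |T|^+ is small. *)
Record monster L (T : theory L) := Monster {
  mon_model :> structure L;
  mon_card : Type;
  mon_models : models mon_model T;
  mon_large : [set: set (formula L nat)] #<= [set: mon_card];
  mon_saturated : saturated mon_model mon_card;
  mon_homogeneous : strongly_homogeneous mon_model mon_card
}.

Definition small L (T : theory L) (Mbar : monster T) (A : set Mbar) : Prop :=
  A #<= [set: mon_card Mbar].

Definition simple_theory L (T : theory L) : Prop :=
  forall (Mbar : monster T) (n : nat) (B : set Mbar)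
         (p : set (pformula Mbar n)),
    small B -> complete_type B p ->
    exists A : set Mbar,
      [/\ A `<=` B, card_le_theory L A & ~ type_divides A p].

Definition SU_rank_one L (T : theory L) : Prop :=
  forall (Mbar : monster T) (A B : set Mbar) (p q : set (pformula Mbar 1)),
    small B -> A `<=` B -> complete_type A p -> complete_type B q ->
    p `<=` q -> ~ algebraic_type p -> type_forks A q -> algebraic_type q.

(* Main.v *)
From HB Require Import structures.
From mathcomp Require Import all_boot all_order all_algebra.
From mathcomp Require Import all_classical all_reals.
From mathcomp Require Import zify lra.
From mathcomp Require wochoice.
Require Import Defs.

Set Implicit Arguments.
Unset Strict Implicit.
Unset Printing Implicit Defensive.

Import Order.TTheory GRing.Theory Num.Theory.

(** Let [Gam] be the free product of four copies of Z/2, with generators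
    [gen i]. The language has a unary function for each element of [Gam] and
    four binary relations [R i]. In the model, [Gam] acts freely and, for every
    [x], the family of sets [R i x] is [legal] on each orbit: every [y] lies in
    at least two of the sets [R i x], and [gen i y] lies in [R i x] for at most
    one [i]. All elements have the same type, so for an invariant measure the
    measure [m i] of [R i x y], as a formula in [x], does not depend on [y]; any
    three of these four sets cover the universe, whence [sum m i >= 4/3], while
    the four sets [R i x (gen i y)] are disjoint, whence [sum m i <= 1]. So
    there is no invariant measure whatsoever, and the formula "true" is the
    required one.

    Legality is a condition on the Cayley tree, and legal configurations can be
    glued along distant balls. Hence a pattern seen by a tuple with two distant
    points in one orbit can also be realized when the points lie in different
    orbits, and conversely, so that truth of a formula depends on finitely much
    of the quantifier-free type. Algebraic closure is closure under [Gam], and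
    outside of it types over the terms of an indiscernible sequence amalgamate
    freely: a formula divides only if it forces an element of the closure.

    A saturated and homogeneous model is built along a well-order in which small
    sets are bounded: at each stage one adds an orbit for every conceivable
    element over the previous stages. *)

Local Open Scope classical_set_scope.
Local Open Scope group_scope.

(** * The group and the legal configurations *)

(** The obstacle is the monster: saturation and strong homogeneity are both wanted over sets of size
    [K], with no cardinal arithmetic that would give a saturated model of its own cardinality.
    Homogeneity is therefore built in. A stage consists of all codes over the previous stages, so an
    automorphism of everything below a stage permutes the codes and extends canonically to that
    stage. A partial isomorphism between small sets is widened beforehand, in ω back-and-forth
    rounds, until its domain and range are the same initial segment of stages. Such a round adds
    images for many orbits at once, with prescribed relations among them; this is why a code
    describes a whole family of new orbits instead of a single one.

    Inside an orbit the relations are the configuration [points] seen from the first argument, so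
    they are the same in every orbit and invariant under right translation. Hence a single point
    carries no information, and [y] and [gen i y] are conjugate. *)

Definition reduced (w : seq 'I_4) : bool := sorted (fun i j => i != j) w.

(** Left multiplication by a generator on reduced words: generators are involutions, so an equal
    head letter cancels. *)
Definition flip (i : 'I_4) (w : seq 'I_4) : seq 'I_4 :=
  if w is j :: w' then if i == j then w' else i :: w else [:: i].

Lemma reduced_flip i w : reduced w -> reduced (flip i w).
Proof.
case: w => [|j w] //= wR; case: eqP => [_|/eqP ij] /=; last by rewrite ij.
exact: path_sorted wR.
Qed.

Lemma flipK i w : reduced w -> flip i (flip i w) = w.
Proof.
case: w => [|j w] /=; first by rewrite eqxx.
case: eqP => [->|/eqP ij] /=; last by rewrite eqxx.
by case: w => [|k w] //= /andP[/negPf ->].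
Qed.

Lemma reduced_foldr u v : reduced v -> reduced (foldr flip v u).
Proof. by move=> vR; elim: u => //= i u IH; exact: reduced_flip. Qed.

Lemma foldr_reduced w : reduced w -> foldr flip [::] w = w.
Proof.
elim: w => //= i w IH wR; rewrite IH; last exact: path_sorted wR.
by case: w wR {IH} => //= j w /andP[/negPf ->].
Qed.

(** The group is realised by its action on reduced words. A cancellation in the acting word is
    harmless because [flip i] is an involution; associativity reduces to this. *)
Lemma foldr_flip_flip x i w : reduced w ->
  foldr flip w (flip i x) = flip i (foldr flip w x).
Proof.
move=> wR; case: x => [|j x] //=; case: eqP => [->|//].
by rewrite flipK // reduced_foldr.
Qed.

Record Gam := MkGam { word : seq 'I_4; wordP : reduced word }.
HB.instance Definition _ := [isSub for word].
HB.instance Definition _ := [Choice of Gam by <:].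

Definition gmul (u v : Gam) : Gam :=
  MkGam (reduced_foldr (word u) (wordP v)).
Definition gone : Gam := @MkGam [::] isT.

Lemma rev_reduced w : reduced w -> reduced (rev w).
Proof.
rewrite /reduced rev_sorted; apply: sub_sorted => i j.
by rewrite eq_sym.
Qed.
Definition ginv (u : Gam) : Gam := MkGam (rev_reduced (wordP u)).

Lemma gmulA : associative gmul.
Proof.
move=> u v w; apply: val_inj => /=.
elim: (word u) => //= i x ->.
by rewrite foldr_flip_flip // wordP.
Qed.
Lemma gmul1g : left_id gone gmul.
Proof. by move=> u; apply: val_inj. Qed.
Lemma gmulg1 : right_id gone gmul.
Proof. by move=> u; apply: val_inj; exact/foldr_reduced/wordP. Qed.
Lemma foldr_rev (w v : seq 'I_4) : reduced v ->
  foldr flip (foldr flip v w) (rev w) = v.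
Proof.
elim: w v => //= i w IH v vR; rewrite rev_cons -cats1 foldr_cat /=.
by rewrite flipK ?IH // reduced_foldr.
Qed.
Lemma gmulVg : left_inverse gone ginv gmul.
Proof.
move=> u; apply: val_inj => /=.
by rewrite -[X in foldr _ X _](foldr_reduced (wordP u)) foldr_rev.
Qed.
Lemma gmulgV : right_inverse gone ginv gmul.
Proof.
move=> u; apply: val_inj => /=.
rewrite -[X in foldr _ _ X]revK.
rewrite -[X in foldr _ X _](foldr_reduced (wordP (ginv u))) /=.
by rewrite foldr_rev.
Qed.
HB.instance Definition _ :=
  isGroup.Build Gam gmulA gmul1g gmulg1 gmulVg gmulgV.

Definition gen (i : 'I_4) : Gam := @MkGam [:: i] isT.

Lemma word_gen i g : word (gen i * g) = flip i (word g).
Proof. by []. Qed.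

Lemma genK i g : gen i * (gen i * g) = g.
Proof. by apply: val_inj; rewrite /= flipK // wordP. Qed.

(* [points g i] says that [gen i * g] is a child of [g] in the Cayley tree
   rooted at the identity. *)
Definition points (g : Gam) (i : 'I_4) : Prop := ohead (word g) != Some i.

Lemma points_flip g i : points (gen i * g) i <-> ~ points g i.
Proof.
rewrite /points word_gen; case: g => [[|j w] wR] /=.
  by rewrite eqxx; split=> // /(_ isT).
have [->|ij] := eqVneq i j; last first.
  rewrite /= eqxx; split => // nij; exfalso; apply: nij.
  by apply: contra ij => /eqP[->].
rewrite eqxx; split=> [_ //|_].
by case: w wR => //= k w /andP[jk _]; apply: contra jk => /eqP[->].
Qed.

Lemma not_points g i j : ~ points g i -> ~ points g j -> i = j.
Proof. by rewrite /points => /negP/negPn/eqP -> /negP/negPn/eqP[]. Qed.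

Definition glen (g : Gam) := size (word g).
Arguments glen g%_g.

Lemma glen_points g i : points g i -> glen (gen i * g) = (glen g).+1.
Proof.
rewrite /points /glen word_gen; case: (word g) => //= j w.
by have [->|ij] := eqVneq i j; rewrite ?eqxx.
Qed.

Lemma size_flip i w : (size (flip i w) <= (size w).+1)%N.
Proof. by case: w => //= j w; case: eqP => //= _; lia. Qed.

Lemma glenM g h : (glen (g * h) <= glen g + glen h)%N.
Proof.
rewrite /glen /=; elim: (word g) => //= i w IH.
by apply: leq_trans (size_flip _ _) _; rewrite addSn ltnS.
Qed.

Lemma glenV g : glen g^-1 = glen g.
Proof. exact: size_rev. Qed.

Lemma glen_gen i : glen (gen i) = 1%N.
Proof. by []. Qed.

(** With [c g i] read as an arrow from [g] to [gen i * g], at least two arrows leave every vertex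
    (no single [i] exhausts them) and at most one enters it. An invariant measure would equate the
    mean numbers of arrows leaving and entering. *)
Definition legal (c : Gam -> 'I_4 -> Prop) : Prop :=
  (forall g i, exists2 k, k != i & c g k) /\
  (forall g i j, c (gen i * g) i -> c (gen j * g) j -> i = j).

Lemma legal_shift c h : legal c -> legal (fun g => c (g * h)).
Proof.
move=> [c1 c2]; split=> [g i|g i j] /=; first exact: c1.
by rewrite -!mulgA; exact: c2.
Qed.

Lemma fourth (i j : 'I_4) : exists k l, [/\ k != l, k != i, k != j, l != i & l != j].
Proof.
have [h hP|] := pickP [pred kl : 'I_4 * 'I_4 | [&& kl.1 != kl.2, kl.1 != i, kl.1 != j,
    kl.2 != i & kl.2 != j]].
  by exists h.1, h.2; case/and5P: hP.
have card_le : (#|[set i; j]%SET| <= 2)%N by rewrite cards2; case: eqP.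
have : (1 < #|~: [set i; j]%SET|)%N.
  by have := cardsC [set i; j]%SET; rewrite card_ord; lia.
move=> /card_gt1P[k [l [kH lH kl]]] /(_ (k, l)) /=.
by move: kH lH; rewrite !inE !negb_or kl => /andP[-> ->] /andP[-> ->].
Qed.

(** In the rooted tree every vertex has at least three children to send arrows to, and receives one
    only from its parent. *)
Lemma legal_points : legal points.
Proof.
split=> [g i|g i j]; last by rewrite !points_flip; exact: not_points.
have [k [l [kl ki _ li _]]] := fourth i i.
have [pk|npk] := pselect (points g k); first by exists k.
exists l => //; apply: contrapT => npl.
by rewrite (not_points npk npl) eqxx in kl.
Qed.

(** * Gluing legal configurations along distant balls *)

Section Glue.
Variables (J : Type) (rho : nat) (ctr : J -> Gam).
Variable c : J -> Gam -> 'I_4 -> Prop.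
Hypothesis cL : forall j, legal (c j).
Hypothesis ctr_far : forall j k,
  (glen (ctr j * (ctr k)^-1) <= 2 * rho + 4)%N -> j = k.

(** The distance from [v] to [w] is [glen (v * w^-1)]: left multiplication by a generator runs along
    an edge, right multiplication is an isometry. *)
Let ball j (v : Gam) := (glen (v * (ctr j)^-1) <= rho)%N.

Let ball_eq j k (v s t : Gam) : ball j (s * v) -> ball k (t * v) ->
  (glen s + glen t <= 4)%N -> j = k.
Proof.
rewrite /ball => bj bk st; apply: ctr_far.
have -> : ctr j * (ctr k)^-1 =
    (s * v * (ctr j)^-1)^-1 * (s * t^-1 * (t * v * (ctr k)^-1)).
  by rewrite !invgM !invgK !mulgA !mulgVK.
apply: leq_trans (glenM _ _) _; rewrite glenV.
have st4 : (glen (s * t^-1) <= 4)%N.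
  by apply: leq_trans (glenM _ _) _; rewrite glenV.
have := leq_add bj (leq_trans (glenM _ _) (leq_add st4 bk)).
by move=> /leq_trans; apply; lia.
Qed.

(** Here [w] receives an arrow from a child inside a ball; its parent, if outside the balls, must
    withhold its own arrow to [w]. *)
Let bad (w : Gam) := exists l j,
  [/\ points w l, ball j (gen l * w) & c j (gen l * w) l].

Let glued (v : Gam) i := (exists2 j, ball j v & c j v i) \/
  [/\ forall j, ~ ball j v, points v i & ~ bad (gen i * v)].

Let glued_in j (v : Gam) i : ball j v -> glued v i <-> c j v i.
Proof.
move=> bj; split=> [[[k bk]|[]]|cv]; last by left; exists j.
  have -> // : j = k; by apply: (@ball_eq _ _ v 1 1); rewrite ?mul1g.
by move=> /(_ j).
Qed.

(* A ball is convex, so at most one of the edges leaving [v] starts a geodesic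
   towards a ball not containing [v]. *)
Let bad_uniq (v : Gam) k l : (forall j, ~ ball j v) -> points v k -> points v l ->
  bad (gen k * v) -> bad (gen l * v) -> k = l.
Proof.
move=> nb pk pl [k' [j [pk' bj _]]] [l' [j' [pl' bj' _]]].
have ? : j = j'.
  (* Both balls contain a point two steps from [v]: this [2 + 2] is the constant 4 in [ctr_far]. *)
  apply: (@ball_eq _ _ v (gen k' * gen k) (gen l' * gen l)).
  - by rewrite -mulgA.
  - by rewrite -mulgA.
  - by have := glenM (gen k') (gen k); have := glenM (gen l') (gen l);
       rewrite !glen_gen; lia.
subst j'; apply: contrapT => kl.
pose t := v * (ctr j)^-1.
(* In a tree, a path without backtracking that starts by leaving the centre keeps leaving it, so its
   end lies in the ball only if [v] does. *)
have bad_far m m' : points (gen m * v) m' -> points v m -> points t m ->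
    ball j (gen m' * (gen m * v)) -> False.
  rewrite /ball -!mulgA -/t => pm' pm ptm.
  have mm' : m != m'.
    apply/eqP => mm'; subst m'; have [+ _] := points_flip v m.
    by move=> /(_ pm').
  have pt' : points (gen m * t) m'.
    move: ptm; rewrite /points word_gen; case: (word t) => [|q w] /=.
      by move=> _; apply: contra mm' => /eqP[->].
    move=> qm; have [mq|_ /=] := eqVneq m q; first by rewrite mq eqxx in qm.
    by apply: contra mm' => /eqP[->].
  rewrite !glen_points // => tr; apply: (nb j); rewrite /ball -/t; lia.
have [ptk|nptk] := pselect (points t k); first exact: bad_far pk' pk ptk bj.
have [ptl|nptl] := pselect (points t l); first exact: bad_far pl' pl ptl bj'.
exact/kl/not_points/nptl.
Qed.

Lemma glue_legal : exists2 c', legal c' &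
  forall j s, (glen s <= rho)%N -> forall i, c' (s * ctr j) i <-> c j (s * ctr j) i.
Proof.
exists glued; last by move=> j s sr i; apply: glued_in; rewrite /ball mulgK.
split=> [v i|v i j].
  have [[j bj]|nb] := pselect (exists j, ball j v).
    by have [k ki ck] := (cL j).1 v i; exists k => //; left; exists j.
  have {}nb j : ~ ball j v by move=> bj; apply: nb; exists j.
  have [m pm] : exists m, forall k, k != m -> points v k.
    rewrite /points; case: (word v) => [|m w]; first by exists ord0.
    by exists m => k km /=; apply: contra km => /eqP[->].
  (* Directions other than [m] lead to children of [v]. Of the two chosen, at most one arrow is
     withheld, by [bad_uniq]. *)
  have [k [l [kl ki km li lm]]] := fourth i m.
  have [bk|nbk] := pselect (bad (gen k * v)); last first.
    by exists k => //; right; split=> //; exact: pm.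
  exists l => //; right; split=> //; first exact: pm.
  by move=> bl; move: kl; rewrite (bad_uniq nb _ _ bk bl) ?eqxx //; exact: pm.
(* An arrow arriving from outside the balls comes from the parent of [v]. One arriving from a ball
   along another edge would come from a child, making [v] bad. *)
have step a b k : ball k (gen a * v) -> c k (gen a * v) a ->
    (forall j, ~ ball j (gen b * v)) -> points (gen b * v) b ->
    ~ bad (gen b * (gen b * v)) -> a = b.
  move=> ba ca nb /points_flip pb; rewrite genK => nbad.
  apply: contrapT => ab; apply: nbad; exists a, k; split=> //.
  by apply: contrapT => pa; exact/ab/not_points/pb.
move=> [[k bk ck]|[nk pk badk]] [[l bl cl]|[nl pl badl]].
- have ? : k = l by apply: (ball_eq bk bl); rewrite !glen_gen.
  by subst l; exact: (cL k).2 ck cl.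
- exact: step bk ck nl pl badl.
- by apply/esym/(step _ _ _ bl cl nk pk badk).
- by apply: (@not_points v); apply/points_flip.
Qed.

End Glue.

(** * Regular well-orders *)

Lemma card_le_injP (T K : Type) (k : K) (A : set T) :
  (A #<= [set: K])%card <->
  exists f : T -> K, forall x y, A x -> A y -> f x = f y -> x = y.
Proof.
split=> [/card_leP[f]|[f fI]]; last first.
  have fJ : {in A &, injective f} by move=> x y /set_mem Ax /set_mem Ay; exact: fI.
  by rewrite -(card_le_eql (inj_card_eq fJ)); exact: subset_card_le.
exists (fun t => if pselect (A t) is left At then \val (f (SigSub (mem_set At))) else k).
move=> x y Ax Ay; case: pselect => // Ax'; case: pselect => // Ay' /val_inj.
by move=> /inj; rewrite !inE => /(_ I I) /(congr1 val).
Qed.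

Record regular_order (K : Type) := RegularOrder {
  W :> Type;
  Wlt : W -> W -> Prop;
  Wwf : well_founded Wlt;
  Wtrans : forall a b c, Wlt a b -> Wlt b c -> Wlt a c;
  Wtotal : forall a b, [\/ Wlt a b, a = b | Wlt b a];
  Wbound : forall A : set W, (A #<= [set: K])%card -> exists w, forall a, A a -> Wlt a w
}.

(** The order is the successor cardinal of [K]: in a well-order of [set K], the points whose initial
    segment injects into [K]. By Cantor there are more than [K] of them, while a union of [K] many
    sets of size [K] has size [K] through the pairing [p]; so a set of size [K] is bounded. *)
Lemma regular_order_exists (K : Type) (p : K -> K -> K) (k0 k1 : K) :
  k0 <> k1 -> (forall a b a' b', p a b = p a' b' -> a = a' /\ b = b') ->
  inhabited (regular_order K).
Proof.
move=> k01 pI; have [R Rwo] := wochoice.well_ordering_principle (set K).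
have Rmin (A : set (set K)) : A !=set0 ->
    exists2 z, A z & forall x, A x -> R z x.
  move=> [x Ax]; have [|z [[zA zmin] _]] := Rwo (mem A); first by exists x; exact: mem_set.
  by exists z => [|y Ay]; [exact: set_mem|apply: zmin; exact: mem_set].
have Rrefl x : R x x by have [|z -> /(_ _ erefl)] := Rmin [set x]; first by exists x.
have Rtot x y : R x y \/ R y x.
  have [|z zE zmin] := Rmin [set z | z = x \/ z = y]; first by exists x; left.
  by case: zE => <-; [left|right]; apply: zmin; [right|left].
have Ranti x y : R x y -> R y x -> x = y.
  move=> xy yx; have [|z [_ zU]] := Rwo (mem [set z | z = x \/ z = y]).
    by exists x; apply: mem_set; left.
  by rewrite -(zU x) ?(zU y) //; (split; first (by apply: mem_set; do [by left|by right]));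
    move=> t /set_mem[] ->.
have Rtr y x z : R x y -> R y z -> R x z.
  move=> xy yz; have [|t tE tmin] := Rmin [set t | [\/ t = x, t = y | t = z]].
    by exists x; constructor 1.
  case: tE => tE; subst t.
  - by apply: tmin; constructor 3.
  - have yx : R y x by apply: tmin; constructor 1.
    by rewrite (Ranti x y).
  - have zy : R z y by apply: tmin; constructor 2.
    by rewrite -(Ranti y z).
pose le := card_le_injP k0.
pose cseg a := [set x | R x a].
pose V := [set a | (cseg a #<= [set: K])%card].
have Vlow a b : R a b -> V b -> V a.
  move=> ab /le[f fI]; apply/le; exists f => x y xa ya.
  by apply: fI; apply: Rtr ab.
have VnK : ~ (V #<= [set: K])%card.
  move=> /[dup] VK /le[f fI].
  have [z nVz zmin] : exists2 z, ~ V z & forall x, ~ V x -> R z x.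
    apply: (Rmin [set z | ~ V z]); apply: contrapT => noV.
    have fJ : injective f.
      by move=> x y; apply: fI; apply: contrapT => nV; apply: noV; eexists; exact: nV.
    pose D := [set k | exists2 X : set K, f X = k & ~ X k].
    have [DD|nDD] := pselect (D (f D)).
      by have [X /fJ XD nX] := DD; apply: nX; rewrite XD.
    by apply: (nDD); exists D.
  apply: nVz; apply/le.
  (* The closed segment of the least [z] outside [V] lies in [V] with one more point; the tags [k0]
     and [k1] make room for it. *)
  exists (fun x => if pselect (x = z) then p k1 k1 else p k0 (f x)) => x y xz yz.
  have inV t : R t z -> t <> z -> V t.
    by move=> tz tnz; apply: contrapT => /zmin zt; apply/tnz/Ranti.
  case: pselect => xE; case: pselect => yE /pI[e1 e2].
  - by rewrite xE.
  - by case: k01; rewrite e1.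
  - by case: k01; rewrite -e1.
  - by apply: fI e2; apply: inV.
have val_inj' (a b : {a | V a}) : sval a = sval b -> a = b.
  by case: a b => a Va [b Vb] /= ab; subst b; congr exist; exact: Prop_irrelevance.
pose lt (a b : {a | V a}) := R (sval a) (sval b) /\ a <> b.
have lttot a b : [\/ lt a b, a = b | lt b a].
  have [->|nab] := pselect (a = b); first by constructor 2.
  have [ab|ba] := Rtot (sval a) (sval b); first by constructor 1.
  by constructor 3; split=> // ba'; apply: nab.
constructor; apply: (@RegularOrder K {a | V a} lt).
- move=> a; apply: contrapT => na.
  have [|z [Vz nz] zmin] := Rmin [set z | exists Vz : V z, ~ Acc lt (exist _ z Vz)].
    by case: a na => a Va; exists a, Va.
  apply: nz; constructor => -[y Vy] [/= yz ynz]; apply: contrapT => ny.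
  by apply: ynz; apply: val_inj' => /=; apply: Ranti => //; apply: zmin; exists Vy.
- move=> a b c [ab nab] [bc nbc]; split; first exact: Rtr bc.
  by move=> ac; subst c; apply/nab/val_inj'/Ranti.
- exact: lttot.
- move=> A /le[g gI]; apply: contrapT => noub; apply: VnK.
  (* If [A] were unbounded, the segments below its elements would cover [V], which would then inject
     into [K]. *)
  have cof (w : {a | V a}) : exists a, A a /\ R (sval w) (sval a).
    apply: contrapT => now; apply: noub; exists w => a Aa.
    have [//|aw|[wa _]] := lttot a w; case: now; exists a; last by [].
    by rewrite aw; split=> //; rewrite -aw.
  have [h hP] := choice cof.
  have [f fP] := choice (fun a : {a | V a} => (le _ _).1 (svalP a)).
  apply/le; exists (fun x => if pselect (V x) is left Vx then
     p (g (h (exist _ x Vx))) (f (h (exist _ x Vx)) x) else k0) => x y Vx Vy.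
  case: pselect => // Vx'; case: pselect => // Vy' /pI[e1 e2].
  have [Ax Rx] := hP (exist _ x Vx'); have [Ay Ry] := hP (exist _ y Vy').
  have e := gI _ _ Ax Ay e1; rewrite -e in e2 Ry.
  exact: fP e2.
Qed.

(** Sequences of sets, so that interleaving is a pairing for any [X]; constant sequences make it at
    least as large as the power set of [X]. *)
Definition K_of (X : Type) := nat -> set X.

Lemma regular_order_K (X : Type) (x : X) : inhabited (regular_order (K_of X)).
Proof.
pose p (f g : K_of X) : K_of X := fun n => if odd n then g n./2 else f n./2.
apply: (@regular_order_exists _ p (fun=> set0) (fun=> setT)) => [e|f g f' g' e].
  have ex : @set0 X x = [set: X] x := congr1 (fun f => f 0%N x) e.
  by suff : @set0 X x by []; rewrite ex.
split; apply/funext => n.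
  by have := congr1 (@^~ n.*2) e; rewrite /p odd_double doubleK.
by have := congr1 (@^~ n.*2.+1) e; rewrite /p /= odd_double uphalf_double.
Qed.

(** * The model, built by stages *)

(** Old orbits are on the left. Among the new ones, those indexed by [nat] serve to realize elements
    and finite tuples, and those indexed by an old orbit serve as its copies in back-and-forth and
    amalgamation. *)
Definition slot (B : Type) := (B + (nat + B))%type.

Definition legal_rows (Z : Type) (E : Z * Gam -> Z * Gam -> 'I_4 -> Prop) :=
  forall p z, legal (fun g => E p (z, g)).

(* An orbit created at stage [a] comes with a prescribed family of relations on
   [slot (Below a)], i.e. between the orbits created before stage [a] and new
   ones indexed by [nat + Below a], together with the index of one of these new
   orbits. *)
Definition node (B : Type) :=
  ({E : slot B * Gam -> slot B * Gam -> 'I_4 -> Prop | legal_rows E} *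
   (nat + B))%type.

Section Orbits.
Variables (K : Type) (O : regular_order K).
Local Notation lt := (@Wlt K O).

Definition Lev_step (a : O) (Lev : forall b, lt b a -> Type) : Type :=
  node {b : O & {h : lt b a & Lev b h}}.
Definition Lev : O -> Type := Fix (@Wwf K O) (fun=> Type) Lev_step.
Definition Below (a : O) := {b : O & {_ : lt b a & Lev b}}.

(** Well-founded recursion into [Type] unfolds only up to a propositional equality; codes are
    therefore read through [cast]. *)
Lemma LevE a : Lev a = node (Below a).
Proof.
rewrite /Lev Fix_eq // => x f g fg; congr Lev_step.
by apply: functional_extensionality_dep => b; apply: funext => h; exact: fg.
Qed.

Definition Orb := {a : O & Lev a}.
Definition lvl (u : Orb) : O := projT1 u.
Definition cast T1 T2 (e : T1 = T2) (x : T1) : T2 := eq_rect T1 id x T2 e.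
Definition nodeof (u : Orb) : node (Below (lvl u)) := cast (LevE (lvl u)) (projT2 u).
Definition incl a (x : Below a) : Orb := existT _ (projT1 x) (projT2 (projT2 x)).

Definition slot_map (B C : Type) (f : B -> C) (z : slot B) : slot C :=
  match z with inl u => inl (f u) | inr (inl n) => inr (inl n) | inr (inr u) =>
      inr (inr (f u)) end.
Definition nslot_map (B C : Type) (f : B -> C) (z : nat + B) : nat + C :=
  match z with inl n => inl n | inr u => inr (f u) end.
Definition pslot_map (B C : Type) (f : B -> C) (p : slot B * Gam) : slot C * Gam :=
  (slot_map f p.1, p.2).

Definition rowsof (u : Orb) (p q : slot Orb * Gam) (i : 'I_4) : Prop :=
  exists p0 q0, [/\ pslot_map (@incl (lvl u)) p0 = p,
    pslot_map (@incl (lvl u)) q0 = q & sval (nodeof u).1 p0 q0 i].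
Definition indexof (u : Orb) : nat + Orb := nslot_map (@incl (lvl u)) (nodeof u).2.

Definition slot_below (a : O) (z : slot Orb) : Prop :=
  match z with inl u => lt (lvl u) a | inr (inl n) => True | inr (inr u) => lt (lvl u) a end.
Definition nslot_below (a : O) (z : nat + Orb) : Prop :=
  match z with inl n => True | inr u => lt (lvl u) a end.

Lemma existT_inj (T : Type) (P : T -> Type) (x : T) (y z : P x) :
  existT P x y = existT P x z -> y = z.
Proof.
move=> e; have := projT2_eq e.
by rewrite (Prop_irrelevance (projT1_eq e) erefl).
Qed.

Lemma incl_inj a : injective (@incl a).
Proof.
move=> [b [h n]] [b' [h' n']]; rewrite /incl /= => e.
have e1 : b = b' by exact: (congr1 (@projT1 _ _) e).
subst b'; have ? := Prop_irrelevance h h'; subst h'.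
by rewrite (existT_inj e).
Qed.

Lemma incl_lvl a (x : Below a) : lt (lvl (incl x)) a.
Proof. by case: x => b [h n]. Qed.

Lemma incl_surj a u : lt (lvl u) a -> exists x : Below a, incl x = u.
Proof. by case: u => b n h; exists (existT _ b (existT _ h n)). Qed.

Lemma slot_map_inj a : injective (slot_map (@incl a)).
Proof.
move=> [x|[n|x]] [y|[m|y]] //= e.
- by rewrite (incl_inj (inl_inj e)).
- by rewrite (inl_inj (inr_inj e)).
- by rewrite (incl_inj (inr_inj (inr_inj e))).
Qed.

Lemma slot_map_below a z : slot_below a (slot_map (@incl a) z).
Proof. by case: z => [x|[n|x]] //=; exact: incl_lvl. Qed.

Lemma slot_map_surj a z : slot_below a z -> exists z0, slot_map (@incl a) z0 = z.
Proof.
case: z => [u|[n|u]] /= => [/incl_surj[x <-]|_|/incl_surj[x <-]].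
- by exists (inl x).
- by exists (inr (inl n)).
- by exists (inr (inr x)).
Qed.

Lemma castK T1 T2 (e : T1 = T2) : cancel (cast (esym e)) (cast e).
Proof. by subst T2. Qed.
Lemma cast_inj T1 T2 (e : T1 = T2) : injective (cast e).
Proof. by subst T2. Qed.

Lemma rowsof_map u p q i :
  rowsof u (pslot_map (@incl (lvl u)) p) (pslot_map (@incl (lvl u)) q) i <->
  sval (nodeof u).1 p q i.
Proof.
split=> [[p0 [q0 []]]|E]; last by exists p, q.
case: p p0 => [z g] [z0 g0] [/slot_map_inj -> ->].
by case: q q0 => [y h] [y0 h0] [/slot_map_inj -> ->].
Qed.

Lemma indexof_below u : nslot_below (lvl u) (indexof u).
Proof. by rewrite /indexof; case: (nodeof u).2 => //= x; exact: incl_lvl. Qed.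

Lemma legal_rowsof u p z : slot_below (lvl u) p.1 -> slot_below (lvl u) z ->
  legal (fun g => rowsof u p (z, g)).
Proof.
case: p => p g /= /slot_map_surj[p0 <-] /slot_map_surj[z0 <-].
suff -> : (fun h => rowsof u (slot_map (@incl (lvl u)) p0, g)
    (slot_map (@incl (lvl u)) z0, h)) =
    (fun h => sval (nodeof u).1 (p0, g) (z0, h)) by exact: (svalP (nodeof u).1).
apply/funext => h; apply/funext => i; apply/propext.
exact: (@rowsof_map u (p0, g) (z0, h)).
Qed.

Lemma Orb_surj a (E : slot Orb * Gam -> slot Orb * Gam -> 'I_4 -> Prop) j :
  legal_rows E -> nslot_below a j ->
  exists u, [/\ lvl u = a, indexof u = j &
    forall p q, slot_below a p.1 -> slot_below a q.1 -> forall i,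
      rowsof u p q i <-> E p q i].
Proof.
move=> EL ja.
pose E0 (p q : slot (Below a) * Gam) :=
  E (pslot_map (@incl a) p) (pslot_map (@incl a) q).
have E0L : legal_rows E0 by move=> p z; exact: EL.
have [j0 j0E] : exists j0, nslot_map (@incl a) j0 = j.
  case: j ja => [n _|u /incl_surj[x <-]]; first by exists (inl n).
  by exists (inr x).
pose u : Orb := existT _ a (cast (esym (LevE a)) (exist _ E0 E0L, j0)).
have uE : nodeof u = (exist _ E0 E0L, j0) by exact: castK.
exists u; split=> //; first by rewrite /indexof uE.
move=> [p g] [q h] /= /slot_map_surj[p0 <-] /slot_map_surj[q0 <-] i.
by have := @rowsof_map u (p0, g) (q0, h) i; rewrite uE.
Qed.

(** An orbit is nothing but its code. Together with [Orb_surj] this makes a stage the set of all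
    codes, so that transporting codes along an isomorphism is a bijection of the stage. *)
Lemma Orb_inj u v : lvl u = lvl v -> indexof u = indexof v ->
  (forall p q, slot_below (lvl u) p.1 -> slot_below (lvl u) q.1 -> forall i,
    rowsof u p q i <-> rowsof v p q i) -> u = v.
Proof.
case: u v => a n [a' n'] /= e; subst a' => ji EE.
suff -> : n = n' by []; apply: (@cast_inj _ _ (LevE a)).
set u : Orb := existT _ a n in ji EE; set v : Orb := existT _ a n' in ji EE.
change (nodeof u = nodeof v).
rewrite [nodeof u]surjective_pairing [nodeof v]surjective_pairing; congr pair.
  have e : sval (nodeof u).1 = sval (nodeof v).1.
    apply/funext => p; apply/funext => q; apply/funext => i; apply/propext.
    apply: iff_trans (iff_sym (@rowsof_map u p q i)) _.
    apply: iff_trans (@rowsof_map v p q i).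
    by apply: EE; exact: slot_map_below.
  case: (nodeof u).1 (nodeof v).1 e => E EL [E' EL'] /= e; subst E'.
  by congr exist; exact: Prop_irrelevance.
move: ji; rewrite /indexof.
case: (nodeof u).2 (nodeof v).2 => [x|x] [y|y] //= e.
  by rewrite (inl_inj e).
by rewrite (incl_inj (inr_inj e)).
Qed.

Definition M : Type := Orb * Gam.
Definition act (g : Gam) (a : M) : M := (a.1, g * a.2).

Definition twins u v := lvl u = lvl v /\ forall p q, slot_below (lvl u) p.1 ->
    slot_below (lvl u) q.1 -> forall i,
    rowsof u p q i <-> rowsof v p q i.

(* Orbits of different stages are related as prescribed by the later one, and
   twin orbits as prescribed by their common extension of the earlier stages; the
   value on other pairs of orbits of the same stage is an arbitrary choice. *)
Definition R (i : 'I_4) (a b : M) : Prop :=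
  if pselect (a.1 = b.1) then points (b.2 * a.2^-1) i
  else if pselect (lt (lvl b.1) (lvl a.1)) then
    rowsof a.1 (inr (indexof a.1), a.2) (inl b.1, b.2) i
  else if pselect (lt (lvl a.1) (lvl b.1)) then
    rowsof b.1 (inl a.1, a.2) (inr (indexof b.1), b.2) i
  else if pselect (twins a.1 b.1) then
    rowsof a.1 (inr (indexof a.1), a.2) (inr (indexof b.1), b.2) i
  else points b.2 i.

Lemma if_selT (P : Prop) (T : Type) (x y : T) : P -> (if pselect P then x else y) = x.
Proof. by case: pselect. Qed.
Lemma if_selF (P : Prop) (T : Type) (x y : T) : ~ P -> (if pselect P then x else y) = y.
Proof. by case: pselect. Qed.

Lemma R_same u g h i : R i (u, g) (u, h) <-> points (h * g^-1) i.
Proof. by rewrite /R if_selT. Qed.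

Lemma lt_irr a : ~ lt a a.
Proof. by move: a; apply: (well_founded_ind (@Wwf K O)) => a IH aa; exact: (IH a aa aa). Qed.

Lemma lt_asym a b : lt a b -> ~ lt b a.
Proof. by move=> ab ba; exact: (@lt_irr a) (Wtrans ab ba). Qed.

Lemma R_gt a b i : lt (lvl b.1) (lvl a.1) ->
  R i a b <-> rowsof a.1 (inr (indexof a.1), a.2) (inl b.1, b.2) i.
Proof.
move=> ba; rewrite /R if_selF ?if_selT // => ab.
by rewrite ab in ba; exact: lt_irr ba.
Qed.

Lemma R_lt a b i : lt (lvl a.1) (lvl b.1) ->
  R i a b <-> rowsof b.1 (inl a.1, a.2) (inr (indexof b.1), b.2) i.
Proof.
move=> ab; have nab : a.1 <> b.1 by move=> e; rewrite e in ab; exact: lt_irr ab.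
by rewrite /R (if_selF _ _ nab) (if_selF _ _ (lt_asym ab)) if_selT.
Qed.

Lemma R_twins a b i : a.1 <> b.1 -> twins a.1 b.1 ->
  R i a b <-> rowsof a.1 (inr (indexof a.1), a.2) (inr (indexof b.1), b.2) i.
Proof.
move=> ab t; have lab : ~ lt (lvl b.1) (lvl a.1) by rewrite t.1; exact: lt_irr.
have lba : ~ lt (lvl a.1) (lvl b.1) by rewrite t.1; exact: lt_irr.
by rewrite /R (if_selF _ _ ab) (if_selF _ _ lab) (if_selF _ _ lba) if_selT.
Qed.

Lemma R_nontwins a b i : lvl a.1 = lvl b.1 -> ~ twins a.1 b.1 ->
  R i a b <-> points b.2 i.
Proof.
move=> l t; rewrite /R !if_selF //; try (by rewrite l; exact: lt_irr).
by move=> e; apply: t; split=> //; rewrite e.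
Qed.

Lemma legal_ext (c c' : Gam -> 'I_4 -> Prop) :
  (forall g i, c g i <-> c' g i) -> legal c' -> legal c.
Proof.
move=> cc'; suff -> : c = c' by [].
by apply/funext => g; apply/funext => i; exact/propext.
Qed.

Lemma legal_R a b : legal (fun g i => R i a (act g b)).
Proof.
case: a b => [u g] [v h]; rewrite /act /=.
suff: legal (fun g' i => R i (u, g) (v, g')) by move=> /(@legal_shift _ h).
have sb := indexof_below.
have [<-|uv] := pselect (u = v).
  by apply: legal_ext (legal_shift g^-1 legal_points) => g' i; exact: R_same.
have [l|l|l] := Wtotal (lvl u) (lvl v).
- by apply: legal_ext (legal_rowsof (p := (inl u, g)) _ (sb v : slot_below _ (inr _))) =>
    // g' i; exact: R_lt.
- have [t|t] := pselect (twins u v).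
    apply: (@legal_ext _ (fun g' => rowsof u (inr (indexof u), g) (inr (indexof v), g'))).
      by move=> g' i; exact: R_twins.
    by apply: legal_rowsof; [exact: sb|rewrite t.1; exact: sb].
  by apply: legal_ext legal_points => g' i; exact: R_nontwins.
- apply: (@legal_ext _ (fun g' => rowsof u (inr (indexof u), g) (inl v, g'))).
    by move=> g' i; exact: R_gt.
  by apply: legal_rowsof => //; exact: sb.
Qed.

(** The new orbits [e j] share the code [H] and differ only by their index; being twins, they are
    related to each other as [H] says. The case [j = k] is left out because relations within an
    orbit are always given by [points]. *)
Lemma extension a (H : slot Orb * Gam -> slot Orb * Gam -> 'I_4 -> Prop) :
  legal_rows H -> exists e : nat + Orb -> Orb, forall j, nslot_below a j ->
  [/\ lvl (e j) = a,
      forall k, nslot_below a k -> e j = e k -> j = k,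
      forall v g h i, lt (lvl v) a ->
        R i (e j, g) (v, h) <-> H (inr j, g) (inl v, h) i,
      forall v g h i, lt (lvl v) a ->
        R i (v, h) (e j, g) <-> H (inl v, h) (inr j, g) i
    & forall k g h i, nslot_below a k -> j <> k ->
        R i (e j, g) (e k, h) <-> H (inr j, g) (inr k, h) i].
Proof.
move=> HL.
have ex j : exists u, nslot_below a j -> [/\ lvl u = a, indexof u = j &
    forall p q, slot_below a p.1 -> slot_below a q.1 -> forall i,
      rowsof u p q i <-> H p q i].
  have [ja|//] := pselect (nslot_below a j).
    by have [u uP] := Orb_surj HL ja; exists u.
  by have [u _] := @Orb_surj a H (inl 0%N) HL I; exists u.
have [e eP] := choice ex.
exists e => j ja; have [ej eji eH] := eP j ja; split=> //.
- by move=> k ka ejk; rewrite -eji ejk; have [] := eP k ka.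
- move=> v g h i va; apply: iff_trans (R_gt _ _) _; rewrite /= ?ej // eji.
  exact: eH.
- move=> v g h i va; apply: iff_trans (R_lt _ _) _; rewrite /= ?ej // eji.
  exact: eH.
- move=> k g h i ka jk; have [ek eki eHk] := eP k ka.
  apply: iff_trans (R_twins _ _ _) _ => /=.
  + by move=> ejk; apply: jk; rewrite -eji ejk.
  + split; rewrite ej ?ek // => p q pa qa i'.
    by apply: iff_trans (eH _ _ _ _ _) (iff_sym (eHk _ _ _ _ _)).
  + by rewrite eji eki; exact: eH.
Qed.

Lemma act1 a : act 1 a = a.
Proof. by case: a => u g; rewrite /act mul1g. Qed.
Lemma actM g h a : act (g * h) a = act g (act h a).
Proof. by rewrite /act /= mulgA. Qed.
Lemma actK g a : act g^-1 (act g a) = a.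
Proof. by rewrite -actM mulVg act1. Qed.
Lemma actKV g a : act g (act g^-1 a) = a.
Proof. by rewrite -actM mulgV act1. Qed.
Lemma act_free g a : act g a = a -> g = 1.
Proof. by case: a => u h [] /(congr1 (fun x => x * h^-1)); rewrite mulgK mulgV. Qed.

Lemma R_diag i g h a b : R i (act g a) (act h a) <-> R i (act g b) (act h b).
Proof.
case: a b => [u x] [v y]; rewrite /act /= !R_same.
by rewrite !invgM !mulgA !mulgK.
Qed.

End Orbits.

(** * Homogeneity of the model *)

Section Homogeneity.
Variables (K : Type) (k0 : K) (O : regular_order K).
Local Notation lt := (@Wlt K O).
Local Notation Orb := (@Orb K O).
Local Notation M := (@M K O).
Implicit Types (f F G : set (M * M)) (a b c : M) (u v w : Orb).

Definition piso f := [/\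
  forall a b g, f (a, b) -> f (act g a, act g b),
  forall a b b', f (a, b) -> f (a, b') -> b = b',
  forall a a' b, f (a, b) -> f (a', b) -> a = a' &
  forall a b a' b' i, f (a, b) -> f (a', b') -> R i a a' <-> R i b b'].

Definition within (s : O) f :=
  forall a b, f (a, b) -> lt (lvl a.1) s /\ lt (lvl b.1) s.

Definition converse f : set (M * M) := [set p | f (p.2, p.1)].

Lemma piso_converse f : piso f -> piso (converse f).
Proof.
move=> [f1 f2 f3 f4]; split; rewrite /converse /=.
- by move=> a b g /f1.
- by move=> a b b' /f3; apply.
- by move=> a a' b /f2; apply.
- by move=> a b a' b' i ab ab'; have := f4 _ _ _ _ i ab ab'; tauto.
Qed.

Lemma within_converse s f : within s f -> within s (converse f).
Proof. by move=> fs a b /fs[]. Qed.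

Lemma piso_directed (FF : set (set (M * M))) :
  (forall p q f g, FF f -> FF g -> f p -> g q -> exists2 h, FF h & h p /\ h q) ->
  (forall f, FF f -> piso f) -> piso (\bigcup_(f in FF) f).
Proof.
move=> dir FP; split.
- by move=> a b g [f Ff fab]; exists f => //; have [f1 _ _ _] := FP f Ff; exact: f1.
- move=> a b b' [f Ff fa] [g Fg ga]; have [h Fh [ha hb]] := dir _ _ _ _ Ff Fg fa ga.
  by have [_ h2 _ _] := FP h Fh; exact: h2 ha hb.
- move=> a a' b [f Ff fa] [g Fg ga]; have [h Fh [ha hb]] := dir _ _ _ _ Ff Fg fa ga.
  by have [_ _ h3 _] := FP h Fh; exact: h3 ha hb.
- move=> a b a' b' i [f Ff fa] [g Fg ga]; have [h Fh [ha hb]] := dir _ _ _ _ Ff Fg fa ga.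
  by have [_ _ _ h4] := FP h Fh; exact: h4 ha hb.
Qed.

Lemma order_unbounded (s : O) : exists s', lt s s'.
Proof.
have [|s' s'P] := @Wbound K O [set s]; last by exists s'; exact: s'P.
by apply/(card_le_injP k0); exists (fun=> k0) => x y -> ->.
Qed.

Lemma order_inhabited : inhabited O.
Proof.
have [|s _] := @Wbound K O set0; last by constructor.
by apply/(card_le_injP k0); exists (fun=> k0).
Qed.

Lemma Orb_inhabited : inhabited Orb.
Proof.
have [s] := order_inhabited.
have [|u _] := @Orb_surj K O s (fun _ q => points q.2) (inl 0%N) _ I; last by constructor.
by move=> p z; exact: legal_points.
Qed.

(** Each orbit below [s] outside the domain is sent to a fresh orbit of stage [s], whose relations
    to the range are read off through the inverse of [f]. *)
Lemma forth s s' f : piso f -> within s f -> lt s s' -> exists f', [/\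
  piso f', f `<=` f', within s' f' &
  forall a, lt (lvl a.1) s -> exists b, f' (a, b)].
Proof.
move=> [f1 f2 f3 f4] fs ss'; have [o0] := Orb_inhabited.
(* [r] is the inverse of [f], made total by the identity off the range. It need not be injective:
   pulling [R] back along an equivariant map keeps rows legal. *)
have exinv b : exists a, (forall a', f (a', b) -> a' = a) /\ ((forall a, ~ f (a, b)) -> a = b).
  have [[a ab]|no] := pselect (exists a, f (a, b)).
    exists a; split=> [a' a'b|/(_ a)//]; exact: f3 a'b ab.
  by exists b; split=> // a' a'b; case: no; exists a'.
have [r rP] := choice exinv.
have rE a b : f (a, b) -> r b = a by move=> /(rP b).1.
have r_act g b : r (act g b) = act g (r b).
  have [[a ab]|no] := pselect (exists a, f (a, b)).
    by rewrite (rE _ _ ab); apply/rE/f1.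
  have -> : r b = b by apply: (rP b).2 => a ab; apply: no; exists a.
  apply: (rP (act g b)).2 => a ab; apply: no.
  by exists (act g^-1 a); rewrite -(actK g b); exact: f1.
pose Pi (p : slot Orb * Gam) : M := match p.1 with
  | inl v => r (v, p.2) | inr (inl n) => (o0, p.2) | inr (inr v) => (v, p.2) end.
have PiE z g : Pi (z, g) = act g (Pi (z, 1)).
  case: z => [v|[n|v]] /=; rewrite /Pi /=; last 2 first.
  - by rewrite /act /= mulg1.
  - by rewrite /act /= mulg1.
  - by rewrite -r_act /act /= mulg1.
pose H p q i := R i (Pi p) (Pi q).
have HL : legal_rows H.
  by move=> p z; apply: legal_ext (legal_R (Pi p) (Pi (z, 1))) => g i; rewrite /H PiE.
have [e eP] := extension s HL.
pose new v := lt (lvl v) s /\ forall g b, ~ f ((v, g), b).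
pose f' := f `|` [set p | exists v g, new v /\ p = ((v, g), (e (inr v), g))].
have elvl v : new v -> lvl (e (inr v)) = s by move=> [vs _]; have [] := eP (inr v) vs.
have crossl a b v g i : f (a, b) -> new v ->
    R i a (v, g) <-> R i b (e (inr v), g).
  move=> ab [vs _]; have [_ _ _ e2 _] := eP (inr v) vs.
  have := e2 b.1 g b.2 i (fs _ _ ab).2; rewrite /H /Pi /= -surjective_pairing.
  by rewrite (rE _ _ ab); tauto.
have crossr a b v g i : f (a, b) -> new v ->
    R i (v, g) a <-> R i (e (inr v), g) b.
  move=> ab [vs _]; have [_ _ e2 _ _] := eP (inr v) vs.
  have := e2 b.1 g b.2 i (fs _ _ ab).2; rewrite /H /Pi /= -surjective_pairing.
  by rewrite (rE _ _ ab); tauto.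
exists f'; split.
- split.
  + move=> a b g [ab|[v [h [vn [-> ->]]]]]; first by left; exact: f1.
    by right; exists v, (g * h).
  + move=> a b b' [ab|[v [h [vn [-> ->]]]]] [ab'|[w [g [wn [e1 e2]]]]].
    * exact: f2 ab ab'.
    * by rewrite e1 in ab; case: (wn.2 _ _ ab).
    * by case: (vn.2 _ _ ab').
    * by rewrite e2; case: e1 => -> ->.
  + move=> a a' b [ab|[v [h [vn [-> ->]]]]] [ab'|[w [g [wn [e1 e2]]]]].
    * exact: f3 ab ab'.
    * have := (fs _ _ ab).2; rewrite e2 elvl // => /lt_irr//.
    * have := (fs _ _ ab').2; rewrite elvl // => /lt_irr//.
    * case: e2 => e2 ->; rewrite e1.
      have [_ eI _ _ _] := eP (inr v) vn.1.
      by have [->] := inr_inj (eI (inr w) wn.1 e2).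
  + move=> a b a' b' i [ab|[v [h [vn [-> ->]]]]] [ab'|[w [g [wn [-> ->]]]]].
    * exact: f4.
    * exact: crossl.
    * exact: crossr.
    * have [->|vw] := pselect (v = w); first by rewrite !R_same.
      have [_ _ _ _ eR] := eP (inr v) vn.1.
      apply: iff_sym; apply: iff_trans (eR (inr w) h g i wn.1 _) _ => //.
      by move=> vw'; apply: vw; exact: inr_inj vw'.
- by move=> p; left.
- move=> a b [ab|[v [h [vn [-> ->]]]]].
    by have [aS bS] := fs _ _ ab; split; exact: Wtrans ss'.
  by split=> /=; rewrite ?elvl //; apply: Wtrans ss'; exact: vn.1.
- move=> [v g] vs.
  have [[b bP]|no] := pselect (exists b, f ((v, g), b)); first by exists b; left.
  exists (e (inr v), g); right; exists v, g; split=> //; split=> // h b vb.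
  by apply: no; exists (act (g * h^-1) b); have := f1 _ _ (g * h^-1) vb; rewrite /act /= mulgVK.
Qed.

Lemma back_and_forth s f : piso f -> within s f -> exists f' s', [/\
  piso f', f `<=` f', lt s s', within s' f' &
  forall a, lt (lvl a.1) s -> (exists b, f' (a, b)) /\ exists b, f' (b, a)].
Proof.
move=> fp fs; have [s1 ss1] := order_unbounded s; have [s2 s12] := order_unbounded s1.
have [f1 [f1p ff1 f1s f1t]] := forth fp fs ss1.
have [f2 [f2p ff2 f2s f2t]] := forth (piso_converse f1p) (within_converse f1s) s12.
exists (converse f2), s2; split.
- exact: piso_converse.
- by move=> [a b] ab; apply: ff2; exact: ff1.
- exact: Wtrans ss1 s12.
- exact: within_converse.
- move=> a sa; split; last by apply: f2t; apply: Wtrans ss1.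
  by have [b ab] := f1t a sa; exists b; exact: (ff2 (b, a)).
Qed.

Definition lower (I : set O) := forall s s', lt s s' -> I s' -> I s.
Definition full (I : set O) f :=
  (forall a b, f (a, b) -> I (lvl a.1) /\ I (lvl b.1)) /\
  (forall a, I (lvl a.1) -> (exists b, f (a, b)) /\ exists b, f (b, a)).

(** Each round covers everything below the previous bound, so in the limit of countably many rounds
    domain and range both consist of all points below some bound. *)
Lemma full_extension s f : piso f -> within s f -> exists F I,
  [/\ piso F, f `<=` F, lower I & full I F].
Proof.
move=> fp fs.
pose S := {x : set (M * M) * O | piso x.1 /\ within x.2 x.1}.
have step (x : S) : exists y : S, [/\ (sval x).1 `<=` (sval y).1,
    lt (sval x).2 (sval y).2 & forall a, lt (lvl a.1) (sval x).2 ->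
      (exists b, (sval y).1 (a, b)) /\ exists b, (sval y).1 (b, a)].
  case: x => -[g t] /= [gp gt]; have [g' [t' [gp' gg' tt' gt' g't]]] := back_and_forth gp gt.
  by exists (exist _ (g', t') (conj gp' gt')).
have [nx nxP] := choice step.
pose q n := iter n nx (exist _ (f, s) (conj fp fs) : S).
have qle m n : (m <= n)%N -> (sval (q m)).1 `<=` (sval (q n)).1.
  move=> /subnK <-; elim: (n - m)%N => //= d IH.
  by apply: subset_trans IH _; have [] := nxP (q (d + m)%N).
exists (\bigcup_(g in [set (sval (q n)).1 | n in setT]) g).
exists [set t | exists n, lt t (sval (q n)).2]; split.
- apply: piso_directed => [p p' _ _ [m _ <-] [n _ <-] pm pn|_ [n _ <-]].
    exists (sval (q (maxn m n))).1; first by exists (maxn m n).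
    by split; [apply: qle pm|apply: qle pn]; rewrite ?leq_maxl ?leq_maxr.
  exact: (svalP (q n)).1.
- by move=> p fp'; exists f => //; exists 0%N.
- by move=> t t' tt' [n nP]; exists n; exact: Wtrans nP.
- split=> [a b [_ [n _ <-] ab]|a [n an]].
    by split; exists n; have [] := (svalP (q n)).2 _ _ ab.
  have [_ _ /(_ _ an)[[b ab] [c ca]]] := nxP (q n).
  by split; [exists b|exists c]; exists (sval (q n.+1)).1 => //; exists n.+1.
Qed.

End Homogeneity.

(** * Transport of codes along an isomorphism of the lower stages *)

Section Level.
Variables (K : Type) (O : regular_order K).
Local Notation lt := (@Wlt K O).
Local Notation Orb := (@Orb K O).
Local Notation M := (@M K O).
Implicit Types (a b c : M) (u v w : Orb).

Definition orb_map (s : M -> M) u : Orb := (s (u, 1)).1.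
(** An old slot stands for actual points, so [s] also moves the group coordinate; a new slot is only
    named by an orbit, hence its name moves and its coordinate stays. *)
Definition slots (s : M -> M) (p : slot Orb * Gam) : slot Orb * Gam :=
  match p.1 with
  | inl v => let b := s (v, p.2) in (inl b.1, b.2)
  | inr z => (inr (nslot_map (orb_map s) z), p.2)
  end.

Record shuffle (t : O) (s s' : M -> M) : Prop := Shuffle {
  shuffleK : cancel s s';
  shuffleKV : cancel s' s;
  shuffle_act : forall g a, s (act g a) = act g (s a);
  shuffle_below : forall a, lt (lvl a.1) t <-> lt (lvl (s a).1) t
}.

Lemma shuffle_sym t s s' : shuffle t s s' -> shuffle t s' s.
Proof.
case=> sK sKV sA sb; split=> // [g a|a].
  by apply: (can_inj sK); rewrite sKV sA sKV.
by have := sb (s' a); rewrite sKV; tauto.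
Qed.

Lemma orb_mapE t s s' : shuffle t s s' -> forall a, (s a).1 = orb_map s a.1.
Proof.
move=> [_ _ sA _] [u g]; have -> : (u, g) = act g (u, 1) by rewrite /act mulg1.
by rewrite sA.
Qed.

Lemma orb_mapK t s s' : shuffle t s s' -> cancel (orb_map s) (orb_map s').
Proof.
move=> ss' u; rewrite {2}/orb_map -(orb_mapE (shuffle_sym ss')).
by rewrite (shuffleK ss').
Qed.

Lemma nslot_mapK t s s' : shuffle t s s' ->
  cancel (nslot_map (orb_map s)) (nslot_map (orb_map s')).
Proof. by move=> ss' [n|u] //=; rewrite (orb_mapK ss'). Qed.

Lemma slotsK t s s' : shuffle t s s' -> cancel (slots s) (slots s').
Proof.
move=> ss' [[u|z] g]; rewrite /slots /=; last by rewrite (nslot_mapK ss').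
by rewrite -surjective_pairing (shuffleK ss').
Qed.

Lemma slots_below t s s' p : shuffle t s s' ->
  slot_below t p.1 -> slot_below t (slots s p).1.
Proof.
move=> ss'; case: p => [[u|[n|u]] g] //=; first by move=> /(shuffle_below ss' (u, g)).
by move=> ut; rewrite -(orb_mapE ss' (u, 1)); exact/(shuffle_below ss' (u, 1)).
Qed.

Lemma slots_act t s s' z : shuffle t s s' ->
  exists z' h, forall g, slots s (z, g) = (z', g * h).
Proof.
move=> ss'; case: z => [u|z].
  exists (inl (s (u, 1)).1), (s (u, 1)).2 => g; rewrite /slots /=.
  have -> : (u, g) = act g (u, 1) by rewrite /act mulg1.
  by rewrite (shuffle_act ss').
by exists (inr (nslot_map (orb_map s) z)), 1 => g; rewrite mulg1.
Qed.

Definition transports (t : O) (s' : M -> M) (s : M -> M) u u' := [/\ lvl u' = t,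
  indexof u' = nslot_map (orb_map s) (indexof u) &
  forall p q, slot_below t p.1 -> slot_below t q.1 -> forall i,
    rowsof u' p q i <-> rowsof u (slots s' p) (slots s' q) i].

Lemma transport t s s' u : shuffle t s s' -> lvl u = t ->
  exists u', transports t s' s u u'.
Proof.
move=> ss' ut.
(* A code must be legal on all slots, while [slots s'] is controlled only below [t]. Elsewhere
   [points] is a harmless default, as [Orb_surj] reads [E] only below [t]. *)
pose E p q i := if pselect (slot_below t p.1 /\ slot_below t q.1) then
  rowsof u (slots s' p) (slots s' q) i else points q.2 i.
have EL : legal_rows E.
  move=> p z; have [pz|npz] := pselect (slot_below t p.1 /\ slot_below t z); last first.
    by apply: legal_ext legal_points => g i; rewrite /E if_selF.
  have [z' [h zE]] := slots_act z (shuffle_sym ss').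
  apply: (@legal_ext _ (fun g => rowsof u (slots s' p) (z', g * h))).
    by move=> g i; rewrite /E if_selT // zE.
  apply: (@legal_shift (fun g => rowsof u (slots s' p) (z', g))).
  apply: legal_rowsof; rewrite ut.
    by apply: (slots_below (shuffle_sym ss')); exact: pz.1.
  by have := slots_below (p := (z, 1)) (shuffle_sym ss') pz.2; rewrite zE.
have jt : nslot_below t (nslot_map (orb_map s) (indexof u)).
  have := indexof_below u; rewrite ut; case: (indexof u) => //= v vt.
  by rewrite -(orb_mapE ss' (v, 1)); exact/(shuffle_below ss' (v, 1)).
have [u' [u't u'j u'E]] := Orb_surj EL jt; exists u'; split=> // p q pt qt i.
by rewrite u'E // /E if_selT.
Qed.

Lemma transports_sym t s s' u u' : shuffle t s s' -> lvl u = t ->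
  transports t s' s u u' -> transports t s s' u' u.
Proof.
move=> ss' ut [u't u'j u'E]; split=> //.
  by rewrite u'j (nslot_mapK ss').
move=> p q pt qt i; apply: iff_sym.
apply: iff_trans (u'E _ _ _ _ i) _; try exact: (slots_below ss').
by rewrite !(slotsK ss').
Qed.

Lemma transports_twins t s s' u u' v v' : shuffle t s s' -> lvl u = t -> lvl v = t ->
  transports t s' s u u' -> transports t s' s v v' -> twins u v -> twins u' v'.
Proof.
move=> ss' ut vt [u't u'j u'E] [v't v'j v'E] [uv uvE]; split; first by rewrite u't.
rewrite u't => p q pt qt i; apply: iff_trans (u'E _ _ pt qt i) _.
apply: iff_trans (iff_sym (v'E _ _ pt qt i)).
by apply: uvE; rewrite ut; exact: (slots_below (shuffle_sym ss')).
Qed.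

Lemma transports_inj t s s' u u' v : shuffle t s s' -> lvl u = t -> lvl v = t ->
  transports t s' s u u' -> transports t s' s v u' -> u = v.
Proof.
move=> ss' ut vt uu' vu'.
have [_ ju uE] := transports_sym ss' ut uu'.
have [_ jv vE] := transports_sym ss' vt vu'.
apply: Orb_inj; rewrite ?ut ?vt ?ju ?jv // => p q pt qt i.
exact: iff_trans (uE _ _ pt qt i) (iff_sym (vE _ _ pt qt i)).
Qed.

Lemma transports_fun t s s' u u' v : shuffle t s s' -> lvl u = t ->
  transports t s' s u u' -> transports t s' s u v -> u' = v.
Proof.
move=> ss' ut uu' uv; apply: (@transports_inj t s' s _ u).
- exact: shuffle_sym.
- by case: uu'.
- by case: uv.
- exact: transports_sym uu'.
- exact: transports_sym uv.
Qed.

End Level.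

Section LevelStep.
Variables (K : Type) (O : regular_order K).
Local Notation lt := (@Wlt K O).
Local Notation Orb := (@Orb K O).
Local Notation M := (@M K O).
Implicit Types (f F G : set (M * M)) (a b c : M) (u v w : Orb).

Definition stage (t : O) : set O := [set x | lt x t].

Lemma full_shuffle t F : piso F -> full (stage t) F -> exists s s',
  shuffle t s s' /\ forall a b, F (a, b) -> s a = b /\ s' b = a.
Proof.
move=> [F1 F2 F3 F4] [Fin Ftot].
have total G : (forall a b b', G (a, b) -> G (a, b') -> b = b') ->
    (forall a, stage t (lvl a.1) -> exists b, G (a, b)) ->
    (forall a b, G (a, b) -> stage t (lvl a.1)) ->
    exists s : M -> M, (forall a b, G (a, b) -> s a = b) /\
      (forall a, ~ stage t (lvl a.1) -> s a = a).
  move=> Gf Gt Gi; have ex a : exists b, (stage t (lvl a.1) -> G (a, b)) /\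
      (~ stage t (lvl a.1) -> b = a).
    have [at_|nat_] := pselect (stage t (lvl a.1)); last by exists a.
    by have [b ab] := Gt a at_; exists b.
  have [s sP] := choice ex; exists s; split=> [a b ab|a /(sP a).2//].
  by apply: (Gf a (s a) b _ ab); apply: (sP a).1; exact: Gi ab.
have [s [sF sN]] := total F F2 (fun a h => (Ftot a h).1) (fun a b h => (Fin a b h).1).
have [s' [s'F s'N]] := total (converse F) (fun a b b' => @F3 b b' a)
  (fun a h => (Ftot a h).2) (fun a b h => (Fin b a h).2).
exists s, s'; split; last first.
  by move=> a b ab; split; [exact: sF|exact: s'F].
split=> [a|a|g a|a].
- have [at_|nat_] := pselect (stage t (lvl a.1)); last by rewrite (sN a) ?s'N.
  by have [[b ab] _] := Ftot a at_; rewrite (sF _ _ ab); exact: s'F.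
- have [at_|nat_] := pselect (stage t (lvl a.1)); last by rewrite (s'N a) ?sN.
  by have [_ [b ab]] := Ftot a at_; rewrite (s'F a b ab); exact: sF.
- have [at_|nat_] := pselect (stage t (lvl a.1)); last by rewrite !sN.
  by have [[b ab] _] := Ftot a at_; rewrite (sF _ _ ab); exact/sF/F1.
- have [at_|nat_] := pselect (stage t (lvl a.1)); last by rewrite sN.
  by have [[b ab] _] := Ftot a at_; rewrite (sF _ _ ab); have [] := Fin _ _ ab.
Qed.

(** Moving codes by [F] permutes stage [t] and preserves twins. The coordinate [g] is kept because
    relations within an orbit, and between orbits of the stage that are not twins, depend on
    coordinates alone. *)
Lemma level_step t F : piso F -> full (stage t) F -> exists F',
  [/\ piso F', F `<=` F' & full (stage t `|` [set t]) F'].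
Proof.
move=> Fp Ff; have [s [s' [ss' sF]]] := full_shuffle Fp Ff.
have [F1 F2 F3 F4] := Fp; have [Fin Ftot] := Ff.
pose tr := transports t s' s.
pose F' := F `|` [set p | exists u u' g,
  [/\ lvl u = t, tr u u' & p = ((u, g), (u', g))]].
have notF u g b : lvl u = t -> ~ F ((u, g), b).
  by move=> ut /Fin[]; rewrite /stage /= ut => /lt_irr.
have notF' u g b : lvl u = t -> ~ F (b, (u, g)).
  by move=> ut /Fin[_]; rewrite /stage /= ut => /lt_irr.
have lvl' u u' : tr u u' -> lvl u' = t by case.
have crossl a b u u' g i : F (a, b) -> lvl u = t -> tr u u' ->
    R i a (u, g) <-> R i b (u', g).
  move=> ab ut uu'; have [at_ bt] := Fin _ _ ab; have [u't u'j u'E] := uu'.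
  apply: iff_trans (R_lt _ _) _; first by rewrite ut.
  apply: iff_sym; apply: iff_trans (R_lt _ _) _; first by rewrite u't.
  apply: iff_trans (u'E _ _ _ _ i) _ => //=.
    by rewrite -u't; exact: indexof_below.
  rewrite /slots /= u'j (nslot_mapK ss') -surjective_pairing (sF _ _ ab).2.
  by [].
have crossr a b u u' g i : F (a, b) -> lvl u = t -> tr u u' ->
    R i (u, g) a <-> R i (u', g) b.
  move=> ab ut uu'; have [at_ bt] := Fin _ _ ab; have [u't u'j u'E] := uu'.
  apply: iff_trans (R_gt _ _) _; first by rewrite ut.
  apply: iff_sym; apply: iff_trans (R_gt _ _) _; first by rewrite u't.
  apply: iff_trans (u'E _ _ _ _ i) _ => //=.
    by rewrite -u't; exact: indexof_below.
  rewrite /slots /= u'j (nslot_mapK ss') -surjective_pairing (sF _ _ ab).2.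
  by [].
exists F'; split.
- split.
  + move=> a b g [ab|[u [u' [h [ut uu' [-> ->]]]]]]; first by left; exact: F1.
    by right; exists u, u', (g * h).
  + move=> a b b' [ab|[u [u' [h [ut uu' [-> ->]]]]]] [ab'|[v [v' [g [vt vv' [e1 e2]]]]]].
    * exact: F2 ab ab'.
    * by rewrite e1 in ab; case: (notF _ _ _ vt ab).
    * by case: (notF _ _ _ ut ab').
    * rewrite e2; case: e1 => e ->; subst v.
      by rewrite (transports_fun ss' ut uu' vv').
  + move=> a a' b [ab|[u [u' [h [ut uu' [-> ->]]]]]] [ab'|[v [v' [g [vt vv' [e1 e2]]]]]].
    * exact: F3 ab ab'.
    * by rewrite e2 in ab; case: (notF' _ _ _ (lvl' _ _ vv') ab).
    * by case: (notF' _ _ _ (lvl' _ _ uu') ab').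
    * rewrite e1; case: e2 => e ->; subst v'.
      by rewrite (transports_inj ss' ut vt uu' vv').
  + move=> a b a' b' i [ab|[u [u' [h [ut uu' [-> ->]]]]]] [ab'|[v [v' [g [vt vv' [-> ->]]]]]].
    * exact: F4.
    * exact: crossl.
    * exact: crossr.
    * have [uv|uv] := pselect (u = v).
        subst v; have := transports_fun ss' ut uu' vv' => e; subst v'.
        by rewrite !R_same.
      have u'v' : u' <> v'.
        by move=> e; subst v'; apply/uv/(transports_inj ss' ut vt uu' vv').
      have ss'' := shuffle_sym ss'.
      have [tw|ntw] := pselect (twins u v); last first.
        apply: iff_trans (R_nontwins _ _ _) _ => //=; first by rewrite ut.
        apply: iff_sym; apply: iff_trans (R_nontwins _ _ _) _ => //=.
          by rewrite (lvl' _ _ uu') (lvl' _ _ vv').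
        move=> tw; apply: ntw.
        apply: (transports_twins ss'' _ _ (transports_sym ss' ut uu') (transports_sym ss' vt
            vv') tw).
          exact: lvl' uu'.
        exact: lvl' vv'.
      have tw' := transports_twins ss' ut vt uu' vv' tw.
      apply: iff_trans (R_twins _ _ _) _ => //=.
      apply: iff_sym; apply: iff_trans (R_twins _ _ _) _ => //=.
      have [u't u'j u'E] := uu'; have [v't v'j v'E] := vv'.
      apply: iff_trans (u'E _ _ _ _ i) _ => /=.
      * by rewrite -u't; exact: indexof_below.
      * by rewrite -v't; exact: indexof_below.
      * by rewrite /slots /= u'j v'j !(nslot_mapK ss').
- by move=> p; left.
- split=> [a b [ab|[u [u' [g [ut uu' [-> ->]]]]]]|[u g] [ut|ut]].
  + by have [] := Fin _ _ ab; split; left.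
  + by split; right=> //=; exact: lvl' uu'.
  + by have [[b ab] [c ca]] := Ftot (u, g) ut; split; [exists b|exists c]; left.
  + have [u' uu'] := transport ss' ut.
    have [v uv] := transport (shuffle_sym ss') ut.
    have vt : lvl v = t by case: uv.
    split; first by exists (u', g); right; exists u, u', g.
    exists (v, g); right; exists v, u, g; split=> //.
    exact: transports_sym (shuffle_sym ss') ut uv.
Qed.

End LevelStep.

Section Extend.
Variables (K : Type) (k0 : K) (O : regular_order K).
Local Notation lt := (@Wlt K O).
Local Notation Orb := (@Orb K O).
Local Notation M := (@M K O).
Implicit Types (f F G : set (M * M)) (a b c : M) (u v w : Orb).

(** If some stage is not covered, the covered ones are exactly those below a least missing [x], and
    [level_step] adds [x]. *)
Lemma maximal_extension (t : O) f : piso f -> within t f -> exists F,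
  [/\ piso F, f `<=` F & full setT F].
Proof.
move=> fp ft; have [F0 [I0 [F0p fF0 I0l I0f]]] := full_extension k0 fp ft.
pose good (X : set (M * M)) := piso X /\ exists I, lower I /\ full I X.
(* Zorn is applied to the sets [G] whose union with [F0] is good, so that the empty chain is covered
   as well. *)
have [FF FFP FFtot|G [[Fp [I [Il If]]] Gmax]] := @Zorn_bigcup _ [set G | good (F0 `|` G)].
  pose fam : set (set (M * M)) := [set X | good X /\ (X = F0 \/ exists2 G,
      FF G & X = F0 `|` G)].
  have famtot X Y : fam X -> fam Y -> X `<=` Y \/ Y `<=` X.
    move=> [_ [->|[G GF ->]]] [_ [->|[H HF ->]]].
    - by left.
    - by left=> x; left.
    - by right=> x; left.
    - by have [GH|HG] := FFtot G H GF HF; [left|right]; exact: setUS.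
  change (good (F0 `|` \bigcup_(X in FF) X)).
  have -> : F0 `|` \bigcup_(X in FF) X = \bigcup_(X in fam) X.
    apply/seteqP; split=> [p [F0p'|[G GF Gp]]|p [X [_ [->|[G GF ->]]]]].
    - by exists F0 => //; split; [split=> //; exists I0|left].
    - exists (F0 `|` G); last by right.
      by split; [exact: FFP|right; exists G].
    - by left.
    - by move=> [F0p'|Gp]; [left|right; exists G].
  split.
    apply: piso_directed => [p q X Y Xf Yf Xp Yq|X [[]]//].
    have [XY|YX] := famtot X Y Xf Yf.
      by exists Y => //; split=> //; exact: XY.
    by exists X => //; split=> //; exact: YX.
  exists [set x | exists X, fam X /\ exists I, [/\ lower I, full I X & I x]]; split.
    move=> x y xy [X [Xf [I [Il If Iy]]]]; exists X; split=> //; exists I; split=> //.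
    exact: Il Iy.
  split=> [a b [X Xf Xab]|a [X [Xf [I [Il If Ia]]]]].
    have [[_ [I [Il If]]] _] := Xf; have [Ia Ib] := If.1 _ _ Xab.
    by split; exists X; split=> //; exists I.
  by have [[b ab] [c ca]] := If.2 a Ia; split; [exists b|exists c]; exists X.
have [IT|/existsNP[x0 nIx]] := pselect (forall x, I x).
  have -> : setT = I by apply/seteqP; split=> // x _; exact: IT.
  by exists (F0 `|` G); split=> // p /fF0; left.
have [x nIx' xmin] : exists2 x, ~ I x & forall y, lt y x -> I y.
  move: nIx; elim/(well_founded_ind (@Wwf K O)): x0 => x IH nIx.
  have [h|/existsNP[y /not_implyP[yx nIy]]] := pselect (forall y, lt y x -> I y);
      first by exists x.
  exact: IH nIy.
have IE : I = stage x.
  apply/seteqP; split=> [y Iy|y]; last exact: xmin.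
  have [//|e|xy] := Wtotal y x; first by rewrite e in Iy.
  by case: nIx'; exact: Il Iy.
rewrite IE in If.
have [F' [F'p FF' F'f]] := level_step Fp If.
case: (Gmax F'); last first.
  change (good (F0 `|` F')).
  have -> : F0 `|` F' = F' by apply/setUidPr => p F0p'; apply: FF'; left.
  split=> //; exists (stage x `|` [set x]); split=> // y z yz [zx|zx]; left.
    exact: Wtrans zx.
  by rewrite -zx.
split=> [p Gp|F'G]; first by apply: FF'; right.
(* Stage [x] is not empty, so [F'] is strictly larger than [G]. *)
have [|u [ux _ _]] := @Orb_surj K O x (fun _ q => points q.2) (inl 0%N) _ Logic.I.
  by move=> p z; exact: legal_points.
have [[b ub] _] := F'f.2 (u, 1) (or_intror ux).
have [] := If.1 (u, 1) b (or_intror (F'G _ ub)).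
by rewrite /stage /= ux => /lt_irr.
Qed.

Definition M_automorphism (s : M -> M) := [/\ bijective s,
  forall g a, s (act g a) = act g (s a) &
  forall i a b, R i a b <-> R i (s a) (s b)].

Lemma homogeneity (t : O) f : piso f -> within t f ->
  exists2 s, M_automorphism s & forall a b, f (a, b) -> s a = b.
Proof.
move=> fp ft; have [F [[F1 F2 F3 F4] fF [_ Ftot]]] := maximal_extension fp ft.
have [s sP] := choice (fun a => (Ftot a I).1).
have [s' s'P] := choice (fun a => (Ftot a I).2).
exists s; last by move=> a b /fF; exact: F2.
split.
- exists s' => a; first by apply: F3 (s'P _) (sP _).
  by apply: F2 (sP _) (s'P _).
- by move=> g a; apply: F2 (sP _) (F1 _ _ _ (sP _)).
- by move=> i a b; apply: F4.
Qed.

Definition qfeq (X : Type) (x y : X -> M) :=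
  (forall j k g, x j = act g (x k) <-> y j = act g (y k)) /\
  (forall j k g h i, R i (act g (x j)) (act h (x k)) <-> R i (act g (y j)) (act h (y k))).

Lemma qfeq_conj (X : Type) (x y : X -> M) (t : O) :
  (forall j, lt (lvl (x j).1) t) -> (forall j, lt (lvl (y j).1) t) -> qfeq x y ->
  exists2 s, M_automorphism s & forall j, s (x j) = y j.
Proof.
move=> xt yt [xy1 xy2].
pose f : set (M * M) := [set p | exists j g, p.1 = act g (x j) /\ p.2 = act g (y j)].
have [|a b [j [g [/= -> ->]]]|s sA sf] := @homogeneity t f.
- split.
  + by move=> a b h [j [g [/= -> ->]]]; exists j, (h * g); rewrite !actM.
  + move=> a b b' [j [g [/= -> ->]]] [k [h [/= e ->]]].
    have : x j = act (g^-1 * h) (x k) by rewrite actM -e actK.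
    by move=> /xy1 ->; rewrite -actM mulVKg.
  + move=> a a' b [j [g [/= -> ->]]] [k [h [/= -> e]]].
    have : y j = act (g^-1 * h) (y k) by rewrite actM -e actK.
    by move=> /xy1 ->; rewrite -actM mulVKg.
  + by move=> a b a' b' i [j [g [/= -> ->]]] [k [h [/= -> ->]]]; exact: xy2.
- by split; [exact: xt|exact: yt].
- exists s => // j; have := sf (x j) (y j); apply.
  by exists j, 1; rewrite !act1.
Qed.

End Extend.

(** * Quantifier elimination *)

Definition L : language := @Language Gam (fun=> 1%N) 'I_4 (fun=> 2%N).

Section Cluster.
Variables (T : eqType) (N : nat -> T -> T -> Prop) (r : nat).
Hypothesis N_trans : forall m n x y z, N m x y -> N n y z -> N (m + n) x z.
Hypothesis N_sym : forall m x y, N m x y -> N m y x.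
Hypothesis N_mono : forall m n x y, (m <= n)%N -> N m x y -> N n x y.

(** A point within [rho] of a merged centre is within [rho + (2 * (rho + r) + 4)] of the surviving
    one, that is [3 * rho + 2 * r + 4]. *)
Fixpoint cluster_bound (n rho : nat) : nat :=
  if n is n'.+1 then cluster_bound n' (3 * rho + 2 * r + 4) else rho.

Lemma cluster_bound_le n rho : (rho <= cluster_bound n rho)%N.
Proof. by elim: n rho => //= n IH rho; apply: leq_trans (IH _); lia. Qed.

(* Points at distance at most [2 * (rho + r) + 4] are merged, at the cost of a
   larger [rho], until the balls of radius [rho + r] around the remaining centers
   are far enough apart for [glue_legal]. *)
Lemma cluster n rho (s0 s : seq T) : (size s <= n)%N ->
  (forall x, x \in s0 -> exists2 y, y \in s & N rho x y) ->
  exists rho' (J : seq T), [/\ (rho' <= cluster_bound n rho)%N, {subset J <= s},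
    forall x, x \in s0 -> exists2 y, y \in J & N rho' x y &
    forall x y, x \in J -> y \in J -> N (2 * (rho' + r) + 4) x y -> x = y].
Proof.
elim: n rho s => [|n IH] rho s sn cov.
  case: s sn cov => // _ cov; exists rho, [::]; split=> //.
have [sep|] := pselect (forall x y, x \in s -> y \in s ->
    N (2 * (rho + r) + 4) x y -> x = y).
  by exists rho, s; split=> //; exact: (cluster_bound_le n.+1).
move=> /existsNP[x /existsNP[y /not_implyP[xs /not_implyP[ys /not_implyP[xy nxy]]]]].
pose s' := [seq z <- s | z != y].
have [|z zs0|rho' [J [rb Js Jcov Jsep]]] := IH (3 * rho + 2 * r + 4)%N s'.
- have : has (fun z => ~~ (z != y)) s by apply/hasP; exists y; rewrite ?eqxx.
  rewrite has_predC all_count -size_filter => h.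
  have := count_size (fun z => z != y) s; rewrite -size_filter -/s'.
  by move: h sn; rewrite -/s'; lia.
- have [w ws zw] := cov z zs0; have [wy|wy] := eqVneq w y.
    exists x; first by rewrite mem_filter xs andbT; apply/eqP.
    rewrite wy in zw; apply: N_mono (N_trans zw (N_sym xy)); lia.
  exists w; first by rewrite mem_filter wy.
  by apply: N_mono zw; lia.
- by exists rho', J; split=> // x' /Js; rewrite mem_filter => /andP[].
Qed.
End Cluster.

(** * Back-and-forth up to a finite radius *)

Section BackForth.
Variables (K : Type) (k0 : K) (O : regular_order K).
Local Notation lt := (@Wlt K O).
Local Notation Orb := (@Orb K O).
Local Notation M := (@M K O).
Implicit Types (a b c : M).

Definition near (r : nat) (g : Gam) : Prop := (glen g <= r)%N.

Lemma nearM m n g h : near m g -> near n h -> near (m + n) (g * h).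
Proof. by move=> gm hn; apply: leq_trans (glenM g h) (leq_add gm hn). Qed.
Lemma nearV m g : near m g -> near m g^-1.
Proof. by rewrite /near glenV. Qed.
Lemma near_mono m n g : (m <= n)%N -> near m g -> near n g.
Proof. by move=> mn gm; exact: leq_trans gm mn. Qed.

(** This is [qfeq] cut off at radius [r], as a formula names only finitely many group elements.
    Equality of points far apart in one orbit is not distinguished from lying in different
    orbits. *)
Definition eqv (X : Type) (r : nat) (u v : X -> M) :=
  (forall j k g, near r g -> u j = act g (u k) <-> v j = act g (v k)) /\
  (forall j k g h i, near r g -> near r h ->
    R i (act g (u j)) (act h (u k)) <-> R i (act g (v j)) (act h (v k))).

Lemma eqv_mono X m n (u v : X -> M) : (m <= n)%N -> eqv n u v -> eqv m u v.
Proof.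
by move=> mn [uv1 uv2]; split=> *; [apply: uv1|apply: uv2]; exact: near_mono mn _.
Qed.
Lemma eqv_sym X r (u v : X -> M) : eqv r u v -> eqv r v u.
Proof. by move=> [uv1 uv2]; split=> *; apply: iff_sym; [exact: uv1|exact: uv2]. Qed.

Lemma act_eq g h a b : act g a = act h b <-> a = act (g^-1 * h) b.
Proof. by rewrite actM; split=> [<-|->]; rewrite ?actK ?actKV. Qed.

Lemma act_orbit a b : a.1 = b.1 -> a = act (a.2 * b.2^-1) b.
Proof. by case: a b => u g [v h] /= ->; rewrite /act /= mulgVK. Qed.

Lemma eqv_act X Y m n (u v : X -> M) (g : Y -> Gam) (f : Y -> X) :
  eqv (m + m + n) u v -> (forall y, near m (g y)) ->
  eqv n (fun y => act (g y) (u (f y))) (fun y => act (g y) (v (f y))).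
Proof.
move=> [uv1 uv2] gm; split=> [j k h hn|j k h h' i hn hn'].
  rewrite -!actM !act_eq; apply: uv1.
  rewrite mulgA -addnA (addnC m n) addnA.
  by apply: nearM (gm k); apply: nearM hn; exact: nearV.
by rewrite -!actM; apply: uv2; apply: near_mono (nearM _ (gm _)); try eassumption; lia.
Qed.

Lemma bounded_tuple (X : Type) (s : seq X) (u : X -> M) :
  exists t, forall x, List.In x s -> lt (lvl (u x).1) t.
Proof.
elim: s => [|x s [t IH]]; first by have [t] := order_inhabited k0 O; exists t.
have [t' xt'] := order_unbounded k0 (lvl (u x).1).
have [tt'|e|t't] := Wtotal t t'.
- by exists t' => y [<-//|/IH yt]; exact: Wtrans tt'.
- by exists t' => y [<-//|/IH yt]; rewrite -e.
- by exists t => y [<-|/IH//]; exact: Wtrans t't.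
Qed.

Section Rows.
Variables (X : eqType) (s : seq X) (r : nat).
Hypothesis sX : forall x, x \in s.
Let bd := cluster_bound r (size s) 0.

Definition legal_row (row : M -> 'I_4 -> Prop) := forall a, legal (fun g => row (act g a)).

(** Around each [v x] in the orbit [o], the new row must copy what [row] does around [u x]. Within a
    cluster the relative positions over [u] and over [v] agree, so one copied ball serves the
    cluster; balls of different clusters are far apart and are glued. *)
Lemma orbit_transfer (u v : X -> M) (row : M -> 'I_4 -> Prop) (o : Orb) :
  eqv bd u v -> legal_row row -> exists2 f, legal f &
  forall x d i, (v x).1 = o -> near r d ->
    f (d * (v x).2) i <-> row (act d (u x)) i.
Proof.
move=> [uv1 uv2] rowL.
pose N k x y := exists2 g, near k g & v x = act g (v y).
pose s0 := [seq x <- s | `[< (v x).1 = o >]].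
have s0P x : x \in s0 <-> (v x).1 = o.
  by rewrite mem_filter sX andbT; split=> /asboolP.
have [||||x xs0|rho [J [rb Js Jcov Jsep]]] := @cluster X N r _ _ _ (size s) 0 s0 s0.
- by move=> m n x y z [g gm xg] [h hn yh]; exists (g * h); rewrite ?actM -?yh //; exact: nearM.
- by move=> m x y [g gm e]; exists g^-1; [exact: nearV|rewrite e actK].
- by move=> m n x y mn [g gm xg]; exists g => //; exact: near_mono gm.
- by rewrite size_filter count_size.
- by exists x => //; exists 1; rewrite ?act1.
pose c (x : {x | x \in J}) (g : Gam) := row (act (g * (v (sval x)).2^-1) (u (sval x))).
have [||c' c'L c'E] := @glue_legal {x | x \in J} (rho + r) (fun x => (v (sval x)).2) c.
- by move=> x; apply: legal_shift (rowL (u (sval x))).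
- move=> [x xJ] [y yJ] /= far; apply: val_inj => /=; apply: Jsep => //.
  exists ((v x).2 * (v y).2^-1) => //; apply: act_orbit.
  by rewrite (s0P x).1 ?(s0P y).1 //; exact: Js.
exists c' => // x d i xo dr.
have [y yJ [g grho xy]] := Jcov x ((s0P x).2 xo).
have ux : u x = act g (u y) by apply/uv1 => //; exact: near_mono rb grho.
have dg : (glen (d * g) <= rho + r)%N by rewrite addnC; exact: nearM.
have -> : d * (v x).2 = d * g * (v y).2 by rewrite xy /act /= mulgA.
by rewrite (c'E (exist _ y yJ) _ dg) /c /= mulgK ux actM.
Qed.

Lemma row_transfer (u v : X -> M) row : eqv bd u v -> legal_row row ->
  exists2 row', legal_row row' & forall x d i, near r d ->
    row' (act d (v x)) i <-> row (act d (u x)) i.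
Proof.
move=> uv rowL.
have ex o : exists f, legal f /\ forall x d i, (v x).1 = o -> near r d ->
    f (d * (v x).2) i <-> row (act d (u x)) i.
  by have [f fL fE] := orbit_transfer o uv rowL; exists f.
have [c cP] := choice ex.
exists (fun a => c a.1 a.2) => [[o h]|x d i dr].
  exact: legal_shift (cP o).1.
by have := (cP (v x).1).2 x d i erefl dr.
Qed.

Definition far (Y : Type) k (u : Y -> M) c := forall x g, near k g -> c <> act g (u x).

(** If [c] lies in an orbit of [u] at all, its distance exceeds [r], which [eqv r] does not see; so
    [d] may be put in a fresh orbit. *)
Lemma far_transfer (u v : X -> M) c : eqv (bd + r + r) u v -> far r u c ->
  exists2 d : M, (forall x, (v x).1 <> d.1) &
    eqv r (fun x => oapp u c x) (fun x => oapp v d x).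
Proof.
move=> uv cfar; have [uv1 uv2] := uv.
have uvbd : eqv bd u v by apply: eqv_mono uv; lia.
have ex1 g : exists row', legal_row row' /\ forall x d i, near r d ->
    row' (act d (v x)) i <-> R i (act g c) (act d (u x)).
  have [|row' rL rE] := @row_transfer u v (fun b i => R i (act g c) b) uvbd.
    by move=> a; exact: legal_R.
  by exists row'.
have [row rowP] := choice ex1.
(* Only points [y] within [r] of the tuple [v] are constrained. Such a [y] may be a translate of
   several [v x]; the corresponding points over [u] coincide by agreement up to radius [r + r]. *)
have ex2 y : exists col : Gam -> 'I_4 -> Prop, legal col /\
    forall x d, near r d -> y = act d (v x) -> forall h i,
      col h i <-> R i (act d (u x)) (act h c).
  have [[x [d [dr ->]]]|no] := pselect (exists x d, near r d /\ y = act d (v x)).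
    exists (fun h i => R i (act d (u x)) (act h c)); split; first exact: legal_R.
    move=> x' d' d'r /act_eq/uv1 e h i.
    suff -> : act d' (u x') = act d (u x) by [].
    apply/esym/act_eq/e; apply: near_mono (nearM (nearV dr) d'r); lia.
  exists points; split; first exact: legal_points.
  by move=> x d dr yE; case: no; exists x, d.
have [col colP] := choice ex2.
pose H (p q : slot Orb * Gam) i := match p.1, q.1 with
  | inr _, inl o => row p.2 (o, q.2) i
  | inl o, inr _ => col (o, p.2) q.2 i
  | _, _ => points q.2 i end.
have HL : legal_rows H.
  move=> [[o|z] g] [o'|z'] /=; try exact: legal_points.
    exact: (colP (o, g)).1.
  have := (rowP g).1 (o', 1); apply: legal_ext => h i.
  by rewrite /H /act /= mulg1.
have sIn x : List.In x s.
  by elim: s (sX x) => //= y s' IH; rewrite inE => /orP[/eqP->|/IH]; [left|right].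
have [t tP] := bounded_tuple s v.
have [e eP] := extension t HL.
have [elvl _ eR1 eR2 _] := eP (inl 0%N) I.
pose d : M := (e (inl 0%N), 1).
have vd x : (v x).1 <> d.1.
  by move=> vE; have := tP x (sIn x); rewrite vE elvl => /lt_irr.
have dR x g h i : near r h -> R i (act g d) (act h (v x)) <-> R i (act g c) (act h (u x)).
  move=> hr; apply: iff_trans ((rowP g).2 x h i hr).
  rewrite /act /= mulg1; exact: (eR1 (v x).1 g (h * (v x).2) i (tP x (sIn x))).
have Rd x g h i : near r g -> R i (act g (v x)) (act h d) <-> R i (act g (u x)) (act h c).
  move=> gr; apply: iff_trans ((colP (act g (v x))).2 x g gr erefl h i).
  rewrite /act /= mulg1; exact: (eR2 (v x).1 h (g * (v x).2) i (tP x (sIn x))).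
exists d => //; split.
- move=> [x|] [y|] g gr /=.
  + by apply: uv1; apply: near_mono gr; lia.
  + split=> e'.
      by case: (cfar x g^-1); [exact: nearV|rewrite e' actK].
    by case: (vd x); rewrite e'.
  + split=> e'; first by case: (cfar y g gr).
    by case: (vd y); rewrite e'.
  + by split=> /esym/act_free ->; rewrite act1.
- move=> [x|] [y|] g h i gr hr /=.
  + by apply: uv2; [apply: near_mono gr|apply: near_mono hr]; lia.
  + exact: (iff_sym (Rd x g h i gr)).
  + exact: (iff_sym (dR y g h i hr)).
  + exact: R_diag.
Qed.

End Rows.

Definition lists (X : Type) (s : seq X) := forall x, List.In x s.

Lemma lists_option X (s : seq X) : lists s -> lists (None :: map Some s).
Proof.
move=> sX [x|]; [right|by left].
by move: (sX x); clear sX; elim: s => //= y s IH [->|/IH]; [left|right].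
Qed.

(** This is the step for one quantifier: an element within [r] of the tuple is copied as the same
    translate, any other goes to a fresh orbit. The first case costs [3 * r], the second a cluster
    bound plus [2 * r]; the radius covers both. *)
Lemma eqv_extend (X : Type) (s : seq X) r : lists s -> exists r', forall u v : X -> M,
  eqv r' u v ->
  (forall c, exists d, eqv r (fun x => oapp u c x) (fun x => oapp v d x)) /\
  (forall c, far r u c -> exists2 d : M, (forall x, (v x).1 <> d.1) &
    eqv r (fun x => oapp u c x) (fun x => oapp v d x)).
Proof.
move=> sX; have sX' (x : {classic X}) : x \in (s : seq {classic X}).
  by move: (sX x); clear sX; elim: s => //= y s IH; rewrite inE => -[->|/IH ->];
      rewrite ?eqxx ?orbT.
exists (cluster_bound r (size s) 0 + r + r + r)%N => u v uv.
have farT c : far r u c -> exists2 d : M, (forall x, (v x).1 <> d.1) &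
    eqv r (fun x => oapp u c x) (fun x => oapp v d x).
  by apply: (far_transfer sX'); apply: eqv_mono uv; exact: leq_addr.
split=> // c; have [[x [g [gr ->]]]|nfar] := pselect (exists x g, near r g /\ c = act g (u x)).
  exists (act g (v x)).
  have := @eqv_act X (option X) r r u v (fun y => if y is Some _ then 1 else g)
    (fun y => if y is Some z then z else x).
  have uv' : eqv (r + r + r) u v by apply: eqv_mono uv; lia.
  move=> /(_ uv').
  have e w : (fun y => act (if y is Some _ then 1 else g) (w (if y is Some z then z else x)))
      = (fun y => oapp w (act g (w x)) y) by apply/funext => -[z|] //=; rewrite act1.
  by rewrite !e; apply=> -[].
have [|d _ dE] := farT c; last by exists d.
by move=> x g gr cE; apply: nfar; exists x, g.
Qed.

Lemma M_inhabited : inhabited M.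
Proof. by have [o] := Orb_inhabited k0 O; constructor; exact: (o, 1). Qed.

Definition M0 : structure L := @Structure L M M_inhabited
  (fun (g : Gam) args => act g (args ord0))
  (fun (i : 'I_4) (args : 'I_2 -> M) => R i (args ord0) (args ord_max)).

Fixpoint term_act (X : Type) (t : term L X) : Gam :=
  match t with Var _ => 1 | App g args => (g : Gam) * term_act (args ord0) end.
Fixpoint term_var (X : Type) (t : term L X) : X :=
  match t with Var x => x | App g args => term_var (args ord0) end.

Lemma eval_term X (t : term L X) (u : X -> M) :
  eval (M := M0) u t = act (term_act t) (u (term_var t)).
Proof. by elim: t => [x|g args IH] /=; rewrite ?act1 // actM IH. Qed.

Lemma sat_local X (phi : formula L X) (s : seq X) : lists s -> exists r,
  forall u v : X -> M, eqv r u v -> sat (M := M0) phi u <-> sat (M := M0) phi v.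
Proof.
elim: phi s => {X} [X|X t1 t2|X i args|X phi IH1 psi IH2|X phi IH] s sX.
- by exists 0%N.
- exists (glen ((term_act t1)^-1 * term_act t2)) => u v [uv _] /=.
  by rewrite !eval_term !act_eq; apply: uv; exact: leqnn.
- exists (maxn (glen (term_act (args ord0))) (glen (term_act (args ord_max)))) => u v [_ uv] /=.
  by rewrite !eval_term; apply: uv; [exact: leq_maxl|exact: leq_maxr].
- have [r1 h1] := IH1 s sX; have [r2 h2] := IH2 s sX.
  exists (maxn r1 r2) => u v uv /=.
  have := h1 u v (eqv_mono (leq_maxl _ _) uv); have := h2 u v (eqv_mono (leq_maxr _ _) uv).
  by tauto.
- have [r h] := IH _ (lists_option sX); have [r' h'] := eqv_extend r sX.
  exists r' => u v uv /=; split=> H c.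
    have [d dP] := (h' v u (eqv_sym uv)).1 c.
    by apply/(h _ _ dP)/H.
  have [d dP] := (h' u v uv).1 c.
  by apply/(h _ _ dP)/H.
Qed.

End BackForth.

(** * Saturation of the model *)

Fixpoint ren_term (X Y : Type) (f : X -> Y) (t : term L X) : term L Y :=
  match t with Var x => Var (f x) | App g args => @App L Y g (fun i => ren_term f (args i)) end.

Fixpoint ren (X Y : Type) (f : X -> Y) (phi : formula L X) : formula L Y :=
  match phi with
  | Fal => Fal
  | Eq t u => Eq (ren_term f t) (ren_term f u)
  | Rel r args => @Rel L Y r (fun i => ren_term f (args i))
  | Imp phi psi => Imp (ren f phi) (ren f psi)
  | All phi => All (ren (omap f) phi)
  end.

Section Syntax.
Variable N : structure L.

Lemma eval_ren X Y (f : X -> Y) (t : term L X) (v : Y -> N) :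
  eval v (ren_term f t) = eval (fun x => v (f x)) t.
Proof. by elim: t => //= g args IH; congr fun_interp; apply/funext => i; exact: IH. Qed.

Lemma sat_ren X Y (f : X -> Y) (phi : formula L X) (v : Y -> N) :
  sat (ren f phi) v <-> sat phi (fun x => v (f x)).
Proof.
elim: phi Y f v => {X} [X|X t u|X r args|X phi IH1 psi IH2|X phi IH] Y f v //=.
- by rewrite !eval_ren.
- suff -> : (fun i => eval v (ren_term f (args i))) =
    (fun i => eval (fun x => v (f x)) (args i)) by [].
  by apply/funext => i; rewrite eval_ren.
- by rewrite IH1 IH2.
- suff h a : sat (ren (omap f) phi) (fun x => oapp v a x) <->
      sat phi (fun x => oapp (fun x => v (f x)) a x).
    by split=> H a; apply/h.
  rewrite IH; suff -> : (fun x => oapp v a (omap f x)) =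
    (fun x => oapp (fun x => v (f x)) a x) by [].
  by apply/funext => -[].
Qed.

Lemma eval_auto (s : N -> N) X (t : term L X) (v : X -> N) : automorphism s ->
  eval (fun x => s (v x)) t = s (eval v t).
Proof.
move=> [_ sf _]; elim: t => //= g args IH.
by rewrite sf; congr fun_interp; apply/funext => i; exact: IH.
Qed.

Lemma sat_auto (s : N -> N) X (phi : formula L X) (v : X -> N) : automorphism s ->
  sat phi v <-> sat phi (fun x => s (v x)).
Proof.
move=> sA; elim: phi v => {X} [X|X t u|X r args|X phi IH1 psi IH2|X phi IH] v //=.
- rewrite !eval_auto //; split=> [->//|]; apply: bij_inj; by case: sA.
- case: (sA) => _ _ sr; rewrite sr.
  suff -> : (fun i => eval (fun x => s (v x)) (args i)) = (fun i => s (eval v (args i))) by [].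
  by apply/funext => i; rewrite eval_auto.
- by rewrite IH1 IH2.
- have e a : (fun x => oapp (fun x => s (v x)) (s a) x) = (fun x => s (oapp v a x)).
    by apply/funext => -[].
  have [[s' sK s'K] _ _] := sA; split=> H a.
    by rewrite -(s'K a) e -IH.
  by rewrite IH -e.
Qed.

End Syntax.

Definition gvar (X : Type) (g : Gam) (x : X) : term L X := @App L X g (fun=> Var x).
Definition feq (X : Type) (g : Gam) (x y : X) : formula L X := Eq (Var x) (gvar g y).
Definition frel (X : Type) (i : 'I_4) (g : Gam) (x : X) (h : Gam) (y : X) : formula L X :=
  @Rel L X i (fun k : 'I_2 => if k == ord0 then gvar g x else gvar h y).

Section Ball.
Fixpoint ball (r : nat) : seq Gam :=
  if r is r'.+1 then ball r' ++ [seq gen i * g | i <- enum 'I_4, g <- ball r'] else [:: 1].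

Lemma ballP r g : near r g -> g \in ball r.
Proof.
elim: r g => [|r IH] g /=.
  rewrite /near leqn0 size_eq0 inE => /eqP g1.
  by apply/eqP/val_inj; rewrite /= g1.
rewrite /near mem_cat leq_eqVlt => /orP[/eqP gr|]; last by rewrite ltnS => /IH ->.
case: g gr => -[//|i w] wR [wr]; apply/orP; right.
have wR' : reduced w by exact: path_sorted wR.
apply/allpairsP; exists (i, MkGam wR'); split=> /=.
- by rewrite mem_enum.
- by apply: IH; rewrite /near /glen /= wr.
apply: val_inj => /=; case: w wR {wr wR'} => //= j w /andP[ij _].
by rewrite (negPf ij).
Qed.
End Ball.

Section Saturation.
Variables (K : Type) (k0 : K) (O : regular_order K).
Local Notation lt := (@Wlt K O).
Local Notation Orb := (@Orb K O).
Local Notation M := (@M K O).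
Local Notation M0 := (@M0 K k0 O).

Lemma M0_automorphism (s : M -> M) : M_automorphism s -> automorphism (M := M0) s.
Proof. by case=> sb sa sR; split=> [//|g args|i args]; [exact: sa|exact: sR]. Qed.

Lemma small_bounded (A : set M) : (A #<= [set: K])%card ->
  exists t, forall a, A a -> lt (lvl a.1) t.
Proof.
move=> AK; have [|t tP] := @Wbound K O [set lvl a.1 | a in A].
  exact: card_le_trans (card_image_le _ _) AK.
by exists t => a Aa; apply: tP; exists a.
Qed.

Lemma max_order (t t' : O) : exists t2, forall x, lt x t \/ lt x t' -> lt x t2.
Proof.
have [tt'|e|t't] := Wtotal t t'.
- by exists t' => x [xt|//]; exact: Wtrans tt'.
- by exists t' => x [|//]; rewrite e.
- by exists t => x [//|xt]; exact: Wtrans t't.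
Qed.

Lemma M0_homogeneous : strongly_homogeneous M0 K.
Proof.
move=> A f AK Af.
have [t tP] := small_bounded AK.
have [t' t'P] : exists t, forall a, (f @` A) a -> lt (lvl a.1) t.
  by apply: small_bounded; exact: card_le_trans (card_image_le _ _) AK.
have [t2 t2P] := max_order t t'.
pose x (a : {a | A a}) := sval a; pose y (a : {a | A a}) := f (sval a).
have [|||s sA sE] := @qfeq_conj K k0 O {a | A a} x y t2.
- by move=> [a Aa]; apply: t2P; left; exact: tP.
- by move=> [a Aa]; apply: t2P; right; apply: t'P; exists a.
- have key (psi : formula L 'I_2) (a b : {a | A a}) :
      sat (M := M0) psi (fun i => if i == ord0 then sval a else sval b) <->
      sat (M := M0) psi (fun i => if i == ord0 then f (sval a) else f (sval b)).
    have -> : (fun i : 'I_2 => if i == ord0 then f (sval a) else f (sval b)) =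
        (fun i => f (if i == ord0 then sval a else sval b)).
      by apply/funext => i; case: ifP.
    by apply: Af => i; case: ifP => _; exact: svalP.
  split=> [a b g|a b g h i].
    exact: (key (feq g ord0 ord_max) a b).
  exact: (key (frel i g ord0 h ord_max) a b).
- by exists s; [exact: M0_automorphism|move=> a Aa; exact: (sE (exist _ a Aa))].
Qed.

End Saturation.

Lemma consistent_fin (N : structure L) n (p : set (pformula N n)) (I : finType)
  (F : I -> pformula N n) : consistent p -> (forall i, p (F i)) ->
  exists a, forall i, psat (F i) a.
Proof.
move=> pC Fp; have [a aP] := pC #|I| (fun k => F (enum_val k)) (fun k => Fp _).
by exists a => i; have := aP (enum_rank i); rewrite enum_rankK.
Qed.

Section TypeFacts.
Variables (N : structure L) (n : nat) (B : set N) (p : set (pformula N n)).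
Hypothesis pB : complete_type B p.

Definition value (a : 'I_n -> N) (y : 'I_n + N) : N :=
  match y with inl i => a i | inr b => b end.
Definition ok (y : 'I_n + N) : Prop := match y with inl _ => True | inr b => B b end.

(** What [p] says about two of its variables or parameters. Entailment by a member of [p] replaces
    membership, since members of [p] come with their own parameter lists. *)
Definition fact (psi : formula L bool) (y z : 'I_n + N) : Prop :=
  exists2 P, p P & forall a, psat P a -> sat psi (fun b : bool => value a (if b then y else z)).

Lemma fact_formula psi y z : ok y -> ok z -> exists2 P : pformula N n, over B P &
  forall a, psat P a <-> sat psi (fun b : bool => value a (if b then y else z)).
Proof.
have key m (w : bool -> 'I_n + 'I_m) (c : 'I_m -> N) : (forall j, B (c j)) ->
    exists2 P : pformula N n, over B P &
    forall a, psat P a <-> sat psi (fun b => cat_val a c (w b)).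
  by move=> cB; exists (PFormula (ren w psi) c) => // a; exact: sat_ren.
have ext (f g : bool -> N) : f true = g true -> f false = g false ->
    sat psi f <-> sat psi g.
  by move=> e1 e2; have -> : f = g by apply/funext => -[].
case: y z => [i|b] [j|b'] /= yB zB.
- have [//|P PB PE] := key 0 (fun b => inl (if b then i else j)) (fun k =>
    False_rect _ (notF (ltn_ord k))).
    by case.
  by exists P => // a; apply: iff_trans (PE a) _; exact: ext.
- have [//|P PB PE] := key 1%N (fun b => if b then inl i else inr ord0) (fun=> b').
  by exists P => // a; apply: iff_trans (PE a) _; exact: ext.
- have [//|P PB PE] := key 1%N (fun b => if b then inr ord0 else inl j) (fun=> b).
  by exists P => // a; apply: iff_trans (PE a) _; exact: ext.
- have [|P PB PE] := key 2 (fun b => inr (if b then ord0 else ord_max)) (fun k =>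
    if k == ord0 then b else b').
    by move=> k; case: ifP.
  by exists P => // a; apply: iff_trans (PE a) _; exact: ext.
Qed.

Lemma fact_decided psi y z : ok y -> ok z -> exists2 P, p P &
  forall a, psat P a -> (sat psi (fun b : bool => value a (if b then y else z)) <-> fact psi
      y z).
Proof.
move=> yB zB; have [P PB PE] := fact_formula psi yB zB; have [_ pC pT] := pB.
have [pP|pP] := pT P PB.
  exists P => // a Pa; split=> _; last exact/PE.
  by exists P => // a' /PE.
exists (pneg P) => // a nPa; split=> [/PE/nPa//|[Q pQ QE]].
have [a' a'P] := @consistent_fin _ _ p bool (fun b => if b then pneg P else Q) pC (fun b =>
    match b with true => pP | false => pQ end).
by case: (a'P true); apply/PE/QE; exact: (a'P false).
Qed.

Lemma fact_approx (I : finType) (psi : I -> formula L bool) (y z : I -> 'I_n + N) phi :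
  p phi -> (forall i, ok (y i)) -> (forall i, ok (z i)) -> exists2 a, psat phi a &
  forall i, sat (psi i) (fun b : bool => value a (if b then y i else z i)) <-> fact (psi i)
      (y i) (z i).
Proof.
move=> pphi yB zB.
have [P PP] := choice (fun i => let: ex_intro2 P h1 h2 := fact_decided (psi i) (yB i) (zB i) in
  ex_intro (fun P => p P /\ forall a, psat P a -> (sat (psi i) (fun b : bool =>
      value a (if b then y i else z i)) <-> fact (psi i) (y i) (z i))) P (conj h1 h2)).
have [_ pC _] := pB.
have [a aP] := @consistent_fin _ _ p (option I) (fun o => if o is Some i then P i else phi) pC
  (fun o => match o with Some i => (PP i).1 | None => pphi end).
exists a; first exact: (aP None).
by move=> i; apply: (PP i).2; exact: (aP (Some i)).
Qed.

Lemma type_nonempty : exists phi, p phi.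
Proof.
have [_ _ pT] := pB.
pose P : pformula N n := PFormula Fal (fun k : 'I_0 => False_rect _ (notF (ltn_ord k))).
have [|h|h] := pT P; first by case.
  by exists P.
by exists (pneg P).
Qed.

End TypeFacts.

Lemma lists_enum (T : finType) : lists (enum T).
Proof.
move=> x; have : x \in enum T by rewrite mem_enum.
by elim: (enum T) => //= y s IH; rewrite inE => /orP[/eqP->|/IH]; [left|right].
Qed.

(** * Realizing a complete type by a tuple of the model *)

Section Realize.
Variables (K : Type) (k0 : K) (O : regular_order K).
Local Notation lt := (@Wlt K O).
Local Notation Orb := (@Orb K O).
Local Notation M := (@M K O).
Local Notation M0 := (@M0 K k0 O).
Variables (n : nat) (B : set M) (p : set (pformula M0 n)) (t : O).
Hypothesis pB : complete_type (M := M0) B p.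
Hypothesis tB : forall b, B b -> lt (lvl b.1) t.

Local Notation Y := ('I_n + M)%type.
Local Notation ok := (@ok M0 n B).
Local Notation value := (@value M0 n).
Implicit Types (y z : Y) (g h c : Gam).

Let E g y z := @fact M0 n p (feq g true false) y z.
Let Q i g y h z := @fact M0 n p (frel i g true h false) y z.

(** Any law of the model about finitely many instances passes to [E] and [Q], since the instances
    can be read off an actual tuple. The laws down to [Q_legal] are all proved in this way. *)
Let approx (le : seq (Gam * Y * Y)) (lr : seq ('I_4 * Gam * Y * Gam * Y)) :
  foldr and True [seq ok x.1.2 /\ ok x.2 | x <- le] ->
  foldr and True [seq ok x.1.1.2 /\ ok x.2 | x <- lr] -> exists a,
  foldr and True [seq E x.1.1 x.1.2 x.2 <-> value a x.1.2 = act x.1.1 (value a x.2) | x <-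
      le] /\
  foldr and True [seq Q x.1.1.1.1 x.1.1.1.2 x.1.1.2 x.1.2 x.2 <->
    R x.1.1.1.1 (act x.1.1.1.2 (value a x.1.1.2)) (act x.1.2 (value a x.2)) | x <- lr].
Proof.
have foldP (T : Type) (P : T -> Prop) (l : seq T) :
    foldr and True [seq P x | x <- l] <-> forall k : 'I_(size l), P (tnth (in_tuple l) k).
  elim: l => [|x l IH] /=; first by split=> // _ [].
  split=> [[Px /IH Pl] k|Pl].
    case: (unliftP ord0 k) => [j ->|->]; rewrite (tnth_nth x) //=.
    by have := Pl j; rewrite (tnth_nth x).
  split; first by have := Pl ord0; rewrite (tnth_nth x).
  by apply/IH => k; have := Pl (lift ord0 k); rewrite !(tnth_nth x).
move=> /foldP leok /foldP lrok; have [phi phip] := type_nonempty pB.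
pose xe k := tnth (in_tuple le) k; pose xr k := tnth (in_tuple lr) k.
have [a _ aP] := @fact_approx M0 n B p pB ('I_(size le) + 'I_(size lr))%type
  (fun k => match k with inl k => feq (xe k).1.1 true false
     | inr k => frel (xr k).1.1.1.1 (xr k).1.1.1.2 true (xr k).1.2 false end)
  (fun k => match k with inl k => (xe k).1.2 | inr k => (xr k).1.1.2 end)
  (fun k => match k with inl k => (xe k).2 | inr k => (xr k).2 end) phi phip
  (fun k => match k with inl k => (leok k).1 | inr k => (lrok k).1 end)
  (fun k => match k with inl k => (leok k).2 | inr k => (lrok k).2 end).
exists a; split; apply/foldP => k; apply: iff_sym.
  exact: (aP (inl k)).
exact: (aP (inr k)).
Qed.

Let E_sym g y z : ok y -> ok z -> E g y z -> E g^-1 z y.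
Proof.
move=> oy oz; have [//|//|a [[e1 [e2 _]] _]] := @approx [:: (g, y, z); (g^-1, z, y)] [::].
by move=> /e1 /= yz; apply/e2 => /=; rewrite yz actK.
Qed.

Let E_left c g y y' z : ok y -> ok y' -> ok z -> E c y y' -> E g y z <-> E (c^-1 * g) y' z.
Proof.
move=> oy oy' oz; have [//|//|a [[e1 [e2 [e3 _]]] _]] :=
  @approx [:: (c, y, y'); (g, y, z); (c^-1 * g, y', z)] [::].
by move=> /e1 /= yy'; rewrite e2 e3 /= yy' act_eq.
Qed.

Let E_right c g y z z' : ok y -> ok z -> ok z' -> E c z z' -> E g y z <-> E (g * c) y z'.
Proof.
move=> oy oz oz'; have [//|//|a [[e1 [e2 [e3 _]]] _]] :=
  @approx [:: (c, z, z'); (g, y, z); (g * c, y, z')] [::].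
by move=> /e1 /= zz'; rewrite e2 e3 /= zz' actM.
Qed.

Let E_same g y : ok y -> E g y y <-> g = 1.
Proof.
move=> oy; have [//|//|a [[e1 _] _]] := @approx [:: (g, y, y)] [::].
by rewrite e1 /=; split=> [/esym/act_free|->]; rewrite ?act1.
Qed.

Let E_par g b b' : B b -> B b' -> E g (inr b) (inr b') <-> b = act g b'.
Proof. by move=> Bb Bb'; have [//|//|a [[e1 _] _]] := @approx [:: (g, inr b, inr b')] [::]. Qed.

Let Q_par i g b h b' : B b -> B b' -> Q i g (inr b) h (inr b') <-> R i (act g b) (act h b').
Proof. by move=> Bb Bb'; have [//|//|a [_ [e1 _]]] := @approx [::] [:: (i, g, inr b, h,
    inr b')]. Qed.

Let Q_same i g h y : ok y -> Q i g y h y <-> points (h * g^-1) i.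
Proof.
move=> oy; have [//|//|a [_ [e1 _]]] := @approx [::] [:: (i, g, y, h, y)].
rewrite e1 /=; case: (value a y) => u x.
by rewrite /act /= R_same invgM mulgA mulgK.
Qed.

Let Q_left c i g y y' h z : ok y -> ok y' -> ok z -> E c y y' ->
  Q i g y h z <-> Q i (g * c) y' h z.
Proof.
move=> oy oy' oz; have [//|//|a [[e1 _] [r1 [r2 _]]]] :=
  @approx [:: (c, y, y')] [:: (i, g, y, h, z); (i, g * c, y', h, z)].
by move=> /e1 /= yy'; rewrite r1 r2 /= yy' actM.
Qed.

Let Q_right c i g y h z z' : ok y -> ok z -> ok z' -> E c z z' ->
  Q i g y h z <-> Q i g y (h * c) z'.
Proof.
move=> oy oz oz'; have [//|//|a [[e1 _] [r1 [r2 _]]]] :=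
  @approx [:: (c, z, z')] [:: (i, g, y, h, z); (i, g, y, h * c, z')].
by move=> /e1 /= zz'; rewrite r1 r2 /= zz' actM.
Qed.

Let Q_legal g y z : ok y -> ok z -> legal (fun h i => Q i g y h z).
Proof.
move=> oy oz; split=> [h i|h i j].
  have [j0 [j1 [j2 [j3 jE]]]] : exists j0 j1 j2 j3, forall k : 'I_4, [\/ k = j0, k = j1,
      k = j2 | k = j3].
    exists ord0, (inord 1), (inord 2), ord_max => -[[|[|[|[|//]]]] kk].
    - by constructor 1; apply: val_inj.
    - by constructor 2; apply: val_inj; rewrite /= inordK.
    - by constructor 3; apply: val_inj; rewrite /= inordK.
    - by constructor 4; apply: val_inj.
  have [//|//|a [_ [r0 [r1 [r2 [r3 _]]]]]] := @approx [::]
    [:: (j0, g, y, h, z); (j1, g, y, h, z); (j2, g, y, h, z); (j3, g, y, h, z)].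
  have [k ki Rk] := (legal_R (act g (value a y)) (value a z)).1 h i.
  by exists k => //; case: (jE k) => e; subst k; [apply/r0|apply/r1|apply/r2|apply/r3].
have [//|//|a [_ [r1 [r2 _]]]] := @approx [::]
  [:: (i, g, y, gen i * h, z); (j, g, y, gen j * h, z)].
move=> /r1 /= R1 /r2 /= R2.
exact: (legal_R (act g (value a y)) (value a z)).2 R1 R2.
Qed.

Let old y := exists g b, B b /\ E g y (inr b).
Let linked (i j : 'I_n) := `[< exists g, E g (inl i) (inl j) >].
(** One variable out of each class that [p] places in a common orbit; only these may get an orbit of
    their own. *)
Let rep (i : 'I_n) : 'I_n := choose (linked i) i.

Let linked_refl i : linked i i.
Proof. by apply/asboolP; exists 1; apply/E_same. Qed.

Let linked_sym i j : linked i j -> linked j i.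
Proof. by move=> /asboolP[g gE]; apply/asboolP; exists g^-1; exact: E_sym. Qed.

Let linked_trans i j k : linked i j -> linked j k -> linked i k.
Proof.
move=> /asboolP[g gE] /asboolP[h hE]; apply/asboolP; exists (g * h).
exact/(E_right _ _ _ _ hE).
Qed.

Let rep_linked i : linked i (rep i).
Proof. exact: chooseP (linked_refl i). Qed.

Let rep_eq i j : linked i j -> rep i = rep j.
Proof.
move=> ij; have e : linked i =1 linked j.
  by move=> k; apply/idP/idP; apply: linked_trans => //; exact: linked_sym.
rewrite /rep (eq_choose e); apply: choose_id => //.
exact: linked_sym.
Qed.

Let based (o : Orb) := exists b, B b /\ b.1 = o.

(** The point with coordinate [x] in the orbit of [b] is [act (x * b.2^-1) b]. Orbits meeting [B]
    are thus expressed by parameters and new slots by variables, so that a code can be written in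
    terms of [Q]. *)
Let location (s : slot Orb) (l : option (Gam * Y)) := match s with
  | inl o => (exists b, [/\ B b, b.1 = o & l = Some (b.2^-1, inr b)]) \/ (~ based o /\ l = None)
  | inr (inl k) => (forall lk : (k < n)%N, l = Some (1, inl (Ordinal lk))) /\ (~ (k < n)%N ->
      l = None)
  | inr (inr _) => l = None end.

Let located s : exists l, location s l.
Proof.
case: s => [o|[k|o]].
- have [[b [Bb bo]]|no] := pselect (based o).
    by exists (Some (b.2^-1, inr b)); left; exists b.
  by exists None; right.
- have [lk|nk] := pselect (k < n)%N; last by exists None.
  exists (Some (1, inl (Ordinal lk))); split=> // lk'.
  by rewrite (bool_irrelevance lk' lk).
- by exists None.
Qed.

(** A variable in the orbit of a parameter is placed there, and one linked to a representative
    follows it; each remaining representative gets a fresh orbit at stage [t], with relations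
    dictated by [Q]. *)
Lemma realize_facts : exists a : 'I_n -> M,
  (forall g y z, ok y -> ok z -> value a y = act g (value a z) <-> E g y z) /\
  (forall i g y h z, ok y -> ok z -> R i (act g (value a y)) (act h (value a z)) <-> Q i g y
      h z).
Proof.
have [loc locP] := choice located.
have locok s g y : loc s = Some (g, y) -> ok y.
  have := locP s; case: s => [o|[k|o]].
  - by case=> [[b [Bb _ ->]] [_ <-]|[_ ->]].
  - case=> h1 h2; have [lk|nk] := pselect (k < n)%N; last by rewrite (h2 nk).
    by rewrite (h1 lk) => -[_ <-].
  - by move=> ->.
pose H (x x' : slot Orb * Gam) i := match loc x.1, loc x'.1 with
  | Some (g, y), Some (h, z) => Q i (x.2 * g) y (x'.2 * h) z
  | _, _ => points x'.2 i end.
have HL : legal_rows H.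
  move=> [x g] x'; rewrite /H /=; case ex: (loc x) => [[c y]|]; last first.
    exact: legal_points.
  case ex': (loc x') => [[c' z]|]; last exact: legal_points.
  exact: legal_shift c' (Q_legal (g * c) (locok _ _ _ ex) (locok _ _ _ ex')).
have [e eP] := extension t HL.
pose d (k : 'I_n) : M := (e (inl (k : nat)), 1).
have dlvl k : lvl (d k).1 = t by have [] := eP (inl (k : nat)) I.
have locd (k : 'I_n) : loc (inr (inl (k : nat))) = Some (1, inl k).
  have [h _] := locP (inr (inl (k : nat))); rewrite (h (ltn_ord k)).
  by congr (Some (_, inl _)); exact: val_inj.
have locb b : B b -> exists b0, [/\ B b0, loc (inl b.1) = Some (b0.2^-1,
    inr b0) & b = act (b.2 * b0.2^-1) b0].
  move=> Bb; case: (locP (inl b.1)) => [[b0 [Bb0 b0b le]]|[nb _]]; last by case: nb; exists b.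
  by exists b0; split=> //; apply: act_orbit.
have dn k b g : B b -> d k <> act g b.
  by move=> Bb dE; have := tB Bb; rewrite -[lvl b.1]/(lvl (act g b).1) -dE dlvl => /lt_irr.
(* Two distinct elements of [basis] share an orbit only if both are parameters, so facts about them
   can be prescribed freely; everything else is a translate of one of them. *)
pose basis y := match y with inr b => B b | inl k => rep k = k /\ ~ old (inl k) end.
pose v y := match y with inr b => b | inl k => d k end.
have basisok y : basis y -> ok y by case: y.
have vE g y z : basis y -> basis z -> v y = act g (v z) <-> E g y z.
  case: y z => [k|b] [l|b'] /= yb zb.
  - have [->|kl] := eqVneq k l.
      by rewrite E_same //; split=> [/esym/act_free|->]; rewrite ?act1.
    split=> [dE|Ekl].
      have [_ eI _ _ _] := eP (inl (k : nat)) I.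
      have := eI (inl (l : nat)) I (congr1 (fun a : M => a.1) dE).
      by move=> e'; rewrite (ord_inj (inl_inj e')) eqxx in kl.
    have /rep_eq : linked k l by apply/asboolP; exists g.
    by rewrite yb.1 zb.1 => kl'; rewrite kl' eqxx in kl.
  - split=> [e'|Eb]; first by case: (dn k b' g zb e').
    by case: yb.2; exists g, b'.
  - split=> [bE|Eb].
      by case: (@dn l b g^-1 yb); rewrite bE actK.
    by case: zb.2; exists g^-1, b; split=> //; exact: E_sym.
  - by apply: iff_sym; exact: E_par.
have vQ i g y h z : basis y -> basis z -> R i (act g (v y)) (act h (v z)) <-> Q i g y h z.
  case: y z => [k|b] [l|b'] /= yb zb.
  - have [->|kl] := eqVneq k l.
      by rewrite Q_same // /act /= R_same !mulg1.
    have [_ _ _ _ eR] := eP (inl (k : nat)) I.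
    have := eR (inl (l : nat)) g h i I; rewrite /H /= !locd !mulg1.
    rewrite /act /= !mulg1; apply=> e'.
    by rewrite (ord_inj (inl_inj e')) eqxx in kl.
  - have [_ _ eR _ _] := eP (inl (k : nat)) I.
    have [b0 [Bb0 lb bE]] := locb b' zb.
    have := eR b'.1 g (h * b'.2) i (tB zb); rewrite /H /= locd lb mulg1 /act /= mulg1 => ->.
    rewrite -mulgA; apply: iff_sym; apply: Q_right => //.
    exact/E_par.
  - have [_ _ _ eR _] := eP (inl (l : nat)) I.
    have [b0 [Bb0 lb bE]] := locb b yb.
    have := eR b.1 h (g * b.2) i (tB yb); rewrite /H /= locd lb mulg1 /act /= mulg1 => ->.
    rewrite -mulgA; apply: iff_sym; apply: Q_left => //.
    exact/E_par.
  - by apply: iff_sym; exact: Q_par.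
have ex i : exists gy, [/\ basis gy.2 & E gy.1 (inl i) gy.2].
  have [[g [b [Bb gE]]]|nold] := pselect (old (inl i)); first by exists (g, inr b).
  have /asboolP[g gE] := rep_linked i.
  exists (g, inl (rep i)); split=> //=; split.
    by apply/esym/rep_eq; exact: rep_linked.
  move=> [h [b [Bb hE]]]; apply: nold; exists (g * h), b; split=> //.
  exact/(E_right _ _ _ _ hE).
have [gy gyP] := choice ex.
pose a i : M := act (gy i).1 (v (gy i).2).
have anchor y : ok y -> exists c y0, [/\ basis y0, E c y y0 & value a y = act c (v y0)].
  case: y => [i _|b Bb].
    by have [h1 h2] := gyP i; exists (gy i).1, (gy i).2.
  by exists 1, (inr b); split=> //=; [exact/E_same|rewrite act1].
exists a; split=> [g y z oy oz|i g y h z oy oz].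
  have [c [y0 [y0b y0E ->]]] := anchor y oy; have [c' [z0 [z0b z0E ->]]] := anchor z oz.
  rewrite -actM act_eq vE //.
  rewrite (E_left _ oy (basisok _ y0b) oz y0E) (E_right _ (basisok _ y0b) oz (basisok _ z0b)
      z0E).
  by rewrite mulgA.
have [c [y0 [y0b y0E ->]]] := anchor y oy; have [c' [z0 [z0b z0E ->]]] := anchor z oz.
rewrite -!actM vQ //.
by rewrite (Q_left _ _ _ oy (basisok _ y0b) oz y0E) (Q_right _ _ _ (basisok _ y0b) oz
    (basisok _ z0b) z0E).
Qed.

(** The tuple agrees with all facts of [p]. For a member of [p] of radius [r], some solution of it
    agrees with the finitely many facts of that radius, and [sat_local] carries its truth over to
    the tuple. *)
Lemma M0_realizes : exists a, realizes (M := M0) a p.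
Proof.
have [a [aE aQ]] := realize_facts; exists a => -[m psi c] phip.
have [pB1 _ _] := pB; have cB : forall j, B (c j) := pB1 _ phip.
pose y (x : 'I_n + 'I_m) : Y := match x with inl i => inl i | inr j => inr (c j) end.
have oky x : ok (y x) by case: x => [i|j] //=; exact: cB.
have valE a' x : value a' (y x) = cat_val (M := M0) a' c x by case: x.
have [r rP] := sat_local k0 O psi (@lists_enum _).
pose N := size (ball r); pose b (k : 'I_N) := nth 1 (ball r) k.
have bP g : near r g -> exists k, g = b k.
  move=> /ballP gb; have gN : (index g (ball r) < N)%N by rewrite index_mem.
  by exists (Ordinal gN); rewrite /b /= nth_index.
pose I := ((('I_n + 'I_m) * ('I_n + 'I_m) * 'I_N) +
  ('I_4 * ('I_n + 'I_m) * ('I_n + 'I_m) * 'I_N * 'I_N))%type.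
have [a' a'phi a'P] := @fact_approx M0 n B p pB I
  (fun k => match k with inl k => feq (b k.2) true false
     | inr k => frel k.1.1.1.1 (b k.1.2) true (b k.2) false end)
  (fun k => match k with inl k => y k.1.1 | inr k => y k.1.1.1.2 end)
  (fun k => match k with inl k => y k.1.2 | inr k => y k.1.1.2 end) _ phip
  (fun k => match k with inl k => oky _ | inr k => oky _ end)
  (fun k => match k with inl k => oky _ | inr k => oky _ end).
apply/(rP (cat_val (M := M0) a' c) (cat_val (M := M0) a c)); last exact: a'phi.
split=> [j k g gr|j k g h i gr hr]; rewrite -!valE.
  have [q ->] := bP g gr.
  apply: iff_trans (iff_sym (aE _ _ _ (oky j) (oky k))).
  exact: (a'P (inl (j, k, q))).
have [q ->] := bP g gr; have [q' ->] := bP h hr.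
apply: iff_trans (iff_sym (aQ _ _ _ _ _ (oky j) (oky k))).
exact: (a'P (inr (i, j, k, q, q'))).
Qed.

End Realize.

Lemma M0_saturated (K : Type) (k0 : K) (O : regular_order K) : saturated (M0 k0 O) K.
Proof.
move=> n B p BK pB; have [t tP] := small_bounded BK.
exact: M0_realizes pB tP.
Qed.

(** * Transfer between models and amalgamation *)

Lemma sat_impls (N : structure L) X (l : seq (formula L X)) (v : X -> N) :
  sat (foldr Imp Fal l) v <-> ~ (forall phi, List.In phi l -> sat phi v).
Proof.
elim: l => [|phi l IH] /=; first by split=> // h; apply: h.
rewrite IH; split=> [h lv|h phiv lv].
  by apply: (h (lv _ (or_introl erefl))) => psi psil; apply: lv; right.
by apply: h => psi [<-//|]; exact: lv.
Qed.

Lemma universal_closure n (phi : formula L 'I_n) : exists chi : sentence L,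
  forall N : structure L, holds N chi <-> forall v : 'I_n -> N, sat phi v.
Proof.
elim: n phi => [|n IH] phi.
  pose f (i : 'I_0) : void := False_rect _ (notF (ltn_ord i)).
  exists (ren f phi) => N; rewrite /holds sat_ren; split=> [h v|]; last exact.
  by have -> : v = (fun x => match f x return N with end) by apply/funext => -[].
have [chi chiP] := IH (All (ren (unlift ord0) phi)).
exists chi => N; rewrite chiP; split=> [h v|h v a /=]; last exact/sat_ren/h.
have /sat_ren/= := h (fun i => v (lift ord0 i)) (v ord0).
suff -> : (fun x => oapp (fun i => v (lift ord0 i)) (v ord0) (unlift ord0 x)) = v by [].
by apply/funext => i; case: unliftP => [j ->|->].
Qed.

Definition same_type (N1 N2 : structure L) (X : Type) (u : X -> N1) (v : X -> N2) :=
  forall phi : formula L X, sat phi u <-> sat phi v.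

Lemma same_type_comp (N1 N2 : structure L) X Y (f : Y -> X) (u : X -> N1) (v : X -> N2) :
  same_type u v -> same_type (fun y => u (f y)) (fun y => v (f y)).
Proof.
move=> uv phi; apply: iff_trans (iff_sym (sat_ren f phi u)) _.
by apply: iff_trans (uv _) _; exact: sat_ren.
Qed.

(** A finite part of the type of [u] that failed in [N2] would give a sentence true in [N2] and
    false in [N1]: the universal closure of its negation. *)
Lemma transfer_ord (N1 N2 : structure L) (K : Type) n (u : 'I_n -> N1) :
  (forall chi : sentence L, holds N1 chi <-> holds N2 chi) -> saturated N2 K ->
  exists v : 'I_n -> N2, same_type u v.
Proof.
move=> N12 N2K; have [pt] := carrier_inhabited N1.
(* [over set0] forces an empty parameter list; [pt] is only a filler. *)
pose ext m (z : 'I_n + 'I_m) := match z with inl i => u i | inr _ => pt end.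
pose p : set (pformula N2 n) := [set P | over set0 P /\ sat (fml P) (ext (par_len P))].
have [||a aP] := N2K n set0 p; first exact: card_ge0.
- split=> [P []//|J s sp|P P0]; last first.
    by have [h|h] := pselect (sat (fml P) (ext (par_len P))); [left|right].
  have ex i : exists psi : formula L 'I_n, forall (N : structure L) (v : 'I_n -> N) w,
      (forall k, w (inl k) = v k) -> sat (fml (s i)) w <-> sat psi v.
    have [ov _] := sp i.
    exists (ren (fun z => match z with inl k => k | inr j =>
        False_rect _ (ov j) end) (fml (s i))).
    move=> N v w wv; rewrite sat_ren.
    suff -> : w = fun x => v (match x with inl k => k | inr j => False_rect _ (ov j) end) by [].
    by apply/funext => -[k|j]; [exact: wv|case: (ov j)].
  have [psi psiP] := choice ex.
  pose l := [seq psi i | i <- enum 'I_J].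
  have lP phi : List.In phi l <-> exists i, phi = psi i.
    rewrite /l; split=> [|[i ->]].
      by elim: (enum 'I_J) => //= i e IH [<-|/IH//]; exists i.
    by have := lists_enum i; elim: (enum 'I_J) => //= j e IH [->|/IH]; [left|right].
  have [chi chiP] := universal_closure (foldr Imp Fal l).
  apply: contrapT => none; have : holds N2 chi.
    apply/chiP => v; rewrite sat_impls => lv; apply: none; exists v => i.
    by apply/(psiP i _ v) => //; apply: lv; apply/lP; exists i.
  move=> /N12/chiP/(_ u); rewrite sat_impls; apply=> _ /lP[i ->].
  by apply/(psiP i _ u (ext _)) => //; exact: (sp i).2.
have key phi : sat phi u -> sat phi a.
  move=> phiu; pose P : pformula N2 n := PFormula (ren inl phi) (fun k : 'I_0 =>
      False_rect _ (notF (ltn_ord k))).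
  have := aP P; rewrite /psat /= sat_ren; apply; split; first by case.
  by rewrite /= sat_ren.
exists a => phi; split; first exact: key.
move=> phia; apply: contrapT => nphi.
exact: (key (Neg phi) nphi phia).
Qed.

Lemma transfer (N1 N2 : structure L) (K : Type) (X : finType) (u : X -> N1) :
  (forall chi : sentence L, holds N1 chi <-> holds N2 chi) -> saturated N2 K ->
  exists v : X -> N2, same_type u v.
Proof.
move=> N12 N2K; have [v uv] := transfer_ord (fun k : 'I_#|X| => u (enum_val k)) N12 N2K.
exists (fun x => v (enum_rank x)).
have := same_type_comp enum_rank uv.
suff -> : (fun y => u (enum_val (enum_rank y))) = u by [].
by apply/funext => x; rewrite enum_rankK.
Qed.

Lemma tuple_conj (N : structure L) (K : Type) (X : finType) (u v : X -> N) :
  strongly_homogeneous N K -> (range u #<= [set: K])%card -> same_type u v ->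
  exists2 s, automorphism s & forall x, s (u x) = v x.
Proof.
move=> NK uK uv.
have ex y : exists z, forall x, u x = y -> z = v x.
  have [[x <-]|no] := pselect (exists x, u x = y); last first.
    by exists y => x xy; case: no; exists x.
  exists (v x) => x' e; apply/esym.
  by have /= := uv (Eq (Var x') (Var x)); rewrite e => -[+ _]; exact.
have [f fP] := choice ex.
have fu x : f (u x) = v x by exact: fP.
have [|s sA sf] := NK (range u) f uK; last first.
  by exists s => // x; rewrite sf //; exists x.
move=> k psi a ua; have ex' i : exists x, u x = a i by have [x _ <-] := ua i; exists x.
have [x xP] := choice ex'.
have -> : a = fun i => u (x i) by apply/funext.
have -> : (fun i => f (u (x i))) = (fun i => v (x i)) by apply/funext => i; exact: fu.
exact: same_type_comp.
Qed.

Section Amalgamation.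
Variables (K : Type) (k0 : K) (O : regular_order K).
Local Notation lt := (@Wlt K O).
Local Notation Orb := (@Orb K O).
Local Notation M := (@M K O).

(* The points of [a] outside the orbits of [b j0] are replaced by points of new
   orbits, related to every [b j] as [a] is to [b j0]. *)
Lemma amalgam (I J X : Type) (a : I -> M) (b : J -> X -> M) (j0 : J) (t : O) :
  (forall i, lt (lvl (a i).1) t) -> (forall j x, lt (lvl (b j x).1) t) ->
  (forall j, qfeq (b j) (b j0)) ->
  (forall j j' x y g, j <> j' -> b j x = act g (b j' y) ->
     b j x = b j0 x /\ b j' y = b j0 y) ->
  (forall i x g, a i = act g (b j0 x) -> forall j, b j x = b j0 x) ->
  exists a' : I -> M, (forall i, lvl (a' i).1 = t \/ lt (lvl (a' i).1) t) /\
    forall j, qfeq (fun z : I + X => match z with inl i => a' i | inr x => b j x end)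
                   (fun z : I + X => match z with inl i => a i | inr x => b j0 x end).
Proof.
move=> at_ bt bq bc ac; have [o0] := Orb_inhabited k0 O.
(* [pi] will send every [b j x] to [b j0 x], equivariantly. It is well defined because different
   terms share an orbit only in coordinates that already equal those of [b j0]. *)
have wd j x g j' x' g' : act g (b j x) = act g' (b j' x') ->
    act g (b j0 x) = act g' (b j0 x').
  move=> /act_eq e; apply/act_eq; have [jj'|jj'] := pselect (j = j').
    by subst j'; exact/((bq j).1 x x').
  by have [<- <-] := bc _ _ _ _ _ jj' e.
have ex y : exists z, (forall j x g, y = act g (b j x) -> z = act g (b j0 x)) /\
    ((forall j x g, y <> act g (b j x)) -> z = y).
  have [[j [x [g ->]]]|no] := pselect (exists j x g, y = act g (b j x)).
    exists (act g (b j0 x)); split=> [j' x' g'|/(_ j x g)//]; exact: wd.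
  by exists y; split=> // j x g yE; case: no; exists j, x, g.
have [pi piP] := choice ex.
have piE j x g : pi (act g (b j x)) = act g (b j0 x) by exact: (piP _).1 erefl.
have pi_act g y : pi (act g y) = act g (pi y).
  have [[j [x [h ->]]]|no] := pselect (exists j x h, y = act h (b j x)).
    by rewrite -actM !piE actM.
  have -> : pi y = y by apply: (piP y).2 => j x h yE; apply: no; exists j, x, h.
  apply: (piP _).2 => j x h yE; apply: no; exists j, x, (g^-1 * h).
  by rewrite actM -yE actK.
pose Pi (p : slot Orb * Gam) : M := match p.1 with
  | inl v => pi (v, p.2) | inr (inl n) => (o0, p.2) | inr (inr v) => (v, p.2) end.
have PiE z g : Pi (z, g) = act g (Pi (z, 1)).
  case: z => [v|[n|v]] /=; rewrite /Pi /=; last 2 first.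
  - by rewrite /act /= mulg1.
  - by rewrite /act /= mulg1.
  - by rewrite -pi_act /act /= mulg1.
pose H p q i := R i (Pi p) (Pi q).
have HL : legal_rows H.
  by move=> p z; apply: legal_ext (legal_R (Pi p) (Pi (z, 1))) => g i; rewrite /H PiE.
have [e eP] := extension t HL.
pose old i := exists x g, a i = act g (b j0 x).
pose a' i := if pselect (old i) then a i else (e (inr (a i).1), (a i).2).
have elvl i : lvl (e (inr (a i).1)) = t by have [] := eP (inr (a i).1) (at_ i).
have a'old i : old i -> a' i = a i by move=> oi; rewrite /a' if_selT.
have a'new i : ~ old i -> a' i = (e (inr (a i).1), (a i).2) by move=> oi; rewrite /a' if_selF.
exists a'; split=> [i|j].
  have [oi|noi] := pselect (old i); first by right; rewrite a'old.
  by left; rewrite a'new //= elvl.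
pose isold (z : I + X) := match z with inl i => old i | inr _ => True end.
pose f (z : I + X) := match z with inl i => a' i | inr x => b j x end.
pose f0 (z : I + X) := match z with inl i => a i | inr x => b j0 x end.
rewrite -/f -/f0.
have oldE z : isold z -> exists x g, f z = act g (b j x) /\ f0 z = act g (b j0 x).
  case: z => [i [x [g aE]]|x _] /=; last by exists x, 1; rewrite !act1.
  by exists x, g; rewrite (a'old i); [rewrite (ac _ _ _ aE)|exists x, g].
have newE z : ~ isold z -> exists i, [/\ z = inl i, ~ old i & f z = (e (inr (a i).1), (a i).2)].
  by case: z => [i noi|x []//]; exists i; split=> //; exact: a'new.
have old_pi z : isold z -> pi (f z) = f0 z.
  by move=> zo; have [x [g [-> ->]]] := oldE z zo; exact: piE.
have old_lvl z : isold z -> lt (lvl (f z).1) t.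
  by move=> zo; have [x [g [-> _]]] := oldE z zo; exact: bt.
split=> [z w g|z w g h i].
- have [zo|/newE[k [-> ko fk]]] := pselect (isold z);
    have [wo|/newE[l [-> lo fl]]] := pselect (isold w).
  + have [x [c [-> ->]]] := oldE z zo; have [y [d [-> ->]]] := oldE w wo.
    by rewrite -!actM !act_eq; exact: (bq j).1.
  + split=> fz.
      by have := old_lvl z zo; rewrite fz fl /= elvl => /lt_irr.
    case: lo; have [x [c [_ zE]]] := oldE z zo; exists x, (g^-1 * c).
    by rewrite actM -zE fz actK.
  + split=> fz.
      have := old_lvl w wo; rewrite -[(f w).1]/((act g (f w)).1) -fz fk /= elvl => /lt_irr//.
    case: ko; have [x [c [_ zE]]] := oldE w wo; exists x, (g * c).
    by rewrite actM -zE -fz.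
  + rewrite fk fl /=; split=> fz.
      have [_ eI _ _ _] := eP (inr (a k).1) (at_ k).
      have e1 := inr_inj (eI (inr (a l).1) (at_ l) (congr1 (fun m : M => m.1) fz)).
      have e2 := congr1 (fun m : M => m.2) fz.
      by rewrite [a k]surjective_pairing e1 [(a k).2]e2.
    by rewrite fz.
- have [zo|/newE[k [-> ko fk]]] := pselect (isold z);
    have [wo|/newE[l [-> lo fl]]] := pselect (isold w).
  + have [x [c [-> ->]]] := oldE z zo; have [y [d [-> ->]]] := oldE w wo.
    by rewrite -!actM; exact: (bq j).2.
  + have [_ _ _ eR _] := eP (inr (a l).1) (at_ l).
    rewrite fl -(old_pi z zo) -pi_act /=.
    exact: (eR (f z).1 (h * (a l).2) (g * (f z).2) i (old_lvl z zo)).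
  + have [_ _ eR _ _] := eP (inr (a k).1) (at_ k).
    rewrite fk -(old_pi w wo) -pi_act /=.
    exact: (eR (f w).1 (g * (a k).2) (h * (f w).2) i (old_lvl w wo)).
  + rewrite fk fl /=; have [e1|e1] := pselect ((a k).1 = (a l).1).
      by rewrite [a k]surjective_pairing [a l]surjective_pairing e1 /act /= !R_same.
    have [_ _ _ _ eR] := eP (inr (a k).1) (at_ k).
    have := eR (inr (a l).1) (g * (a k).2) (h * (a l).2) i (at_ l).
    by apply=> kl; apply: e1; exact: inr_inj kl.
Qed.

End Amalgamation.

(** * Forking in models of the theory *)

Lemma eq_iff (P Q : Prop) : P = Q -> P <-> Q.
Proof. by move=> ->. Qed.

Section Models.
Variables (K : Type) (k0 : K) (O : regular_order K).
Local Notation lt := (@Wlt K O).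
Local Notation M := (@M K O).
Local Notation M0 := (@M0 K k0 O).
Variables (N : structure L) (KN : Type).
Hypothesis N_M0 : forall chi : sentence L, holds N chi <-> holds M0 chi.
Hypothesis N_sat : saturated N KN.
Hypothesis N_hom : strongly_homogeneous N KN.
Hypothesis N_fin : forall (X : finType) (u : X -> N), (range u #<= [set: KN])%card.

Definition actN (g : Gam) (a : N) : N := @fun_interp L N (g : fun_sym L) (fun=> a).

Lemma to_M0 (X : finType) (u : X -> N) : exists v : X -> M, @same_type N M0 X u v.
Proof. exact: (@transfer N M0 K X u N_M0 (@M0_saturated K k0 O)). Qed.

(** Saturation gives a copy in [N] of the whole tuple [w0]; homogeneity then moves its [Y] part onto
    the given [u]. *)
Lemma of_M0 (X Y : finType) (u : Y -> N) (w0 : X + Y -> M) :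
  @same_type N M0 Y u (fun y => w0 (inr y)) ->
  exists a : X -> N, @same_type N M0 (X + Y)%type
    (fun z => match z with inl x => a x | inr y => u y end) w0.
Proof.
move=> uw0.
have [w w0w] : exists w : (X + Y)%type -> N, @same_type M0 N _ w0 w.
  by apply: transfer N_sat => chi; exact: (iff_sym (N_M0 chi)).
have [||s sA sE] := @tuple_conj N KN Y (fun y => w (inr y)) u N_hom.
- exact: N_fin.
- by move=> phi; rewrite uw0; exact: (iff_sym (same_type_comp inr w0w phi)).
exists (fun x => s (w (inl x))) => phi; apply: iff_sym.
apply: iff_trans (w0w phi) _; apply: iff_trans (sat_auto phi w sA) _; apply: iff_sym.
suff e : (fun z => match z with inl x => s (w (inl x)) | inr y => u y end) = (fun z => s (w z)).
  exact: eq_iff (congr1 (fun h => sat phi h) e).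
by apply/funext => -[x|y] //; exact: (esym (sE y)).
Qed.

Lemma bounded_fin (X : finType) (v : X -> M) : exists t, forall x, lt (lvl (v x).1) t.
Proof.
have [t tP] := bounded_tuple k0 (enum X) v.
by exists t => x; apply: tP; exact: lists_enum.
Qed.

Lemma actN1 a : actN 1 a = a.
Proof.
have [v uv] := to_M0 (fun _ : 'I_1 => a).
exact/esym/(uv (feq 1 ord0 ord0))/esym/act1.
Qed.

Lemma actNM g h a : actN (g * h) a = actN g (actN h a).
Proof.
have [v uv] := to_M0 (fun _ : 'I_1 => a).
apply/(uv (Eq (gvar (g * h) ord0) (@App L _ (g : fun_sym L) (fun=> gvar h ord0)))).
exact: actM.
Qed.

Lemma actNK g a : actN g^-1 (actN g a) = a.
Proof. by rewrite -actNM mulVg actN1. Qed.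

Lemma actN_inj g : injective (actN g).
Proof. by move=> a b ab; rewrite -(actNK g a) ab actNK. Qed.

Lemma actN_free g h a : actN g a = actN h a -> g = h.
Proof.
have [v uv] := to_M0 (fun _ : 'I_1 => a).
move=> /(uv (Eq (gvar g ord0) (gvar h ord0))) /= /(@act_eq K O) e.
by have /act_free/(congr1 (fun x => g * x)) := esym e; rewrite mulVKg mulg1.
Qed.

Section Indiscernible.
Variables (m : nat) (b : nat -> 'I_m -> N).
Hypothesis bI : indiscernible set0 b.

Let no_par (k : 'I_0) : N := False_rect _ (notF (ltn_ord k)).

Lemma indiscernible1 (psi : formula L 'I_m) j k : sat psi (b j) <-> sat psi (b k).
Proof.
have [//|//|//|] := bI (ren (fun x => inl (ord0 : 'I_1, x)) psi) (c := no_par) (f :=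
    fun=> j) (g := fun=> k) _ _ _.
- by case.
- by move=> x y; rewrite !ord1.
- by move=> x y; rewrite !ord1.
by rewrite !sat_ren.
Qed.

Lemma indiscernible2 (psi : formula L ('I_m + 'I_m)) p q p' q' : (p < q)%N -> (p' < q')%N ->
  sat psi (cat_val (b p) (b q)) -> sat psi (cat_val (b p') (b q')).
Proof.
move=> pq pq'.
pose w (z : 'I_m + 'I_m) : 'I_2 * 'I_m + 'I_0 :=
  match z with inl x => inl (ord0, x) | inr x => inl (ord_max, x) end.
have homo2 r s : (r < s)%N -> {homo (fun k : 'I_2 =>
    if k == ord0 then r else s) : i j / (i < j)%N}.
  move=> rs i j ij; have -> : i = ord0 by apply: val_inj => /=; case: i j ij => i ? [j ?] /=;
      lia.
  by have -> : j = ord_max by apply: val_inj => /=; case: i j ij => i ? [j ?] /=; lia.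
have := @bI _ _ (ren w psi) no_par _ _ _ (homo2 _ _ pq) (homo2 _ _ pq').
rewrite !sat_ren => h.
have e r s : (fun x => seq_val b (fun k : 'I_2 => if k == ord0 then r else s) no_par (w x)) =
    cat_val (b r) (b s).
  by apply/funext => -[].
by rewrite -!e; apply h; case.
Qed.

(** By indiscernibility the relation holds between any two terms in the same order; comparing two
    terms with a common third one shows that the coordinate does not vary. *)
Lemma indiscernible_orbits j j' x y g : j <> j' -> b j x = actN g (b j' y) ->
  b j x = b 0%N x /\ b j' y = b 0%N y.
Proof.
move=> jj' e.
have const z : b 1%N z = b 2%N z -> forall k, b k z = b 0%N z.
  move=> b12 [//|k].
  have := @indiscernible2 (Eq (Var (inl z)) (Var (inr z))) 1 2 0 k.+1 isT isT.
  by move=> /(_ b12) /= ->.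
have [lt_|lt_|//] := ltngtP j j'.
- have all p q : (p < q)%N -> b p x = actN g (b q y).
    by move=> pq; exact: (@indiscernible2 (feq g (inl x) (inr y)) j j' p q).
  split; apply: const.
    by rewrite (all 1%N 3) // (all 2%N 3).
  by apply: (@actN_inj g); rewrite -(all 0%N) // -(all 0%N).
- have all p q : (p < q)%N -> b q x = actN g (b p y).
    by move=> pq; exact: (@indiscernible2 (feq g (inr x) (inl y)) j' j p q).
  split; apply: const.
    by rewrite (all 0%N 1%N) // (all 0%N 2).
  by apply: (@actN_inj g); rewrite -(all _ 3) // -(all _ 3).
Qed.

(** Finitely many terms are copied into the explicit model, where [amalgam] yields one tuple related
    to all of them as [a] is to the initial term; [of_M0] brings it back. The hypothesis on orbits
    says that [a] meets the closure of that term only through constant coordinates. *)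
Lemma nondividing n (phi : formula L ('I_n + 'I_m)) (a : 'I_n -> N) :
  sat phi (cat_val a (b 0%N)) ->
  (forall i x g, a i = actN g (b 0%N x) -> forall j, b j x = b 0%N x) ->
  consistent [set psi | exists j, psi = PFormula phi (b j)].
Proof.
move=> phia ab J s sb; have [e eP] := choice sb.
(* One more than the largest index, so that the initial term is included even when [J] is 0. *)
pose Jn := (\max_(i < J) e i).+1.
have eJ i : (e i < Jn)%N by rewrite ltnS; exact: leq_bigmax.
pose u (z : 'I_n + 'I_Jn * 'I_m) := match z with inl i => a i | inr q => b q.1 q.2 end.
have [v uv] : exists v : ('I_n + 'I_Jn * 'I_m)%type -> M, @same_type N M0 _ u v := to_M0 u.
pose a0 i := v (inl i); pose b0 (j : 'I_Jn) x := v (inr (j, x)).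
have [t tP] := bounded_fin v.
have b0E x y g j j' : b0 j x = act g (b0 j' y) <-> b j x = actN g (b j' y).
  exact: (iff_sym (uv (feq g (inr (j, x)) (inr (j', y))))).  
have b0C x (j : 'I_Jn) : b j x = b 0%N x -> b0 j x = b0 ord0 x.
  exact: (uv (Eq (Var (inr (j, x))) (Var (inr (ord0, x))))).1.
have b0q j : qfeq (b0 j) (b0 ord0).
  have st (psi : formula L 'I_m) : sat (M := M0) psi (b0 j) <-> sat (M := M0) psi (b0 ord0).
    have := same_type_comp (fun x => inr (j, x)) uv psi.
    have := same_type_comp (fun x => inr (ord0, x)) uv psi.
    by have /= := indiscernible1 psi j 0; tauto.
  split=> [x y g|x y g h i]; first exact: (st (feq g x y)).
  exact: (st (frel i g x h y)).
have [||||a' [a't a'q]] := @amalgam K k0 O 'I_n 'I_Jn 'I_m a0 b0 ord0 t _ _ b0q.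
- by move=> i; exact: tP.
- by move=> j x; exact: tP.
- move=> j j' x y g jj' /b0E /indiscernible_orbits[].
    by move=> jj''; apply: jj'; exact: ord_inj.
  by move=> h1 h2; split; exact: b0C.
- move=> i x g ai j; apply: b0C; apply: ab.
  exact: (uv (feq g (inl i) (inr (ord0, x)))).2 ai.
have [t' tt'] := order_unbounded k0 t.
have phia' j : sat (M := M0) phi (cat_val (M := M0) a' (b0 j)).
  have [||s' sA sE] := qfeq_conj k0 (t := t') _ _ (a'q j).
  - move=> [i|x] /=; last exact: Wtrans (tP _) tt'.
    by have [e'|h] := a't i; [rewrite e'|exact: Wtrans h tt'].
  - by move=> [i|x]; exact: Wtrans (tP _) tt'.
  apply: (sat_auto phi (cat_val (M := M0) a' (b0 j)) (M0_automorphism k0 sA)).2.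
  have := (same_type_comp (fun z : 'I_n + 'I_m => match z with inl i => inl i | inr x =>
      inr (ord0, x) end) uv phi).1.
  have -> : (fun z : 'I_n + 'I_m => u (match z with inl i => inl i | inr x => inr (ord0,
      x) end)) = cat_val a (b 0%N).
    by apply/funext => -[].
  move=> /(_ phia).
  suff -> : (fun x => s' (cat_val (M := M0) a' (b0 j) x)) = (fun z =>
      v (match z with inl i => inl i | inr x => inr (ord0, x) end)) by [].
  by apply/funext => -[i|x]; [exact: (sE (inl i))|exact: (sE (inr x))].
have [a'' a''P] := @of_M0 'I_n ('I_Jn * 'I_m)%type (fun q => b q.1 q.2)
  (fun z => match z with inl i => a' i | inr q => v (inr q) end) (same_type_comp inr uv).
exists a'' => i; rewrite /psat (eP i) /=.
have := same_type_comp (fun z : 'I_n + 'I_m => match z with inl i => inl i | inr x =>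
    inr (Ordinal (eJ i), x) end) a''P phi.
have := phia' (Ordinal (eJ i)).
have -> : cat_val a'' (b (e i)) = fun z : 'I_n + 'I_m => match (match z with inl i =>
    inl i | inr x => inr (Ordinal (eJ i), x) end) with inl x => a'' x | inr q => b q.1 q.2 end.
  by apply/funext => -[].
move=> h1 h2; apply/h2.
suff <- : cat_val (M := M0) a' (b0 (Ordinal (eJ i))) = fun z : 'I_n + 'I_m =>
    match (match z with inl i => inl i | inr x => inr (Ordinal (eJ i), x) end) with inl x =>
        a' x | inr q => v (inr q) end by [].
by apply/funext => -[].
Qed.

End Indiscernible.

End Models.

Fixpoint alternating (k : nat) : Gam :=
  if k is k'.+1 then gen (if odd k' then ord_max else ord0) * alternating k' else 1.

Lemma glen_alternating k : glen (alternating k) = k.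
Proof.
suff [] : glen (alternating k) = k /\ points (alternating k) (if odd k then ord_max else
    ord0) by [].
elim: k => //= k [lk pk]; split; first by rewrite glen_points // lk.
rewrite /points; move: pk; rewrite /points word_gen.
by case: (word (alternating k)) => [|q w] /=; case: (odd k) => //=;
  have [<-|] := eqVneq _ q; rewrite ?eqxx.
Qed.

(** * Rank one, local character, and the sets to be measured *)

Section Consequences.
Variables (K : Type) (k0 : K) (O : regular_order K).
Local Notation lt := (@Wlt K O).
Local Notation M := (@M K O).
Local Notation M0 := (@M0 K k0 O).
Variables (N : structure L) (KN : Type).
Hypothesis N_M0 : forall chi : sentence L, holds N chi <-> holds M0 chi.
Hypothesis N_sat : saturated N KN.
Hypothesis N_hom : strongly_homogeneous N KN.
Hypothesis N_fin : forall (X : finType) (u : X -> N), (range u #<= [set: KN])%card.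
Local Notation actN := (@actN N).
Local Notation to_M0 := (@to_M0 K k0 O N N_M0).
Local Notation of_M0 := (@of_M0 K k0 O N KN N_M0 N_sat N_hom N_fin).

Lemma infinite_domain (n : nat) : ~ finite_set [set: 'I_n.+1 -> N].
Proof.
apply/infiniteP; have [y] := carrier_inhabited N.
have fI : {in [set: nat] &, injective (fun k => (fun=> actN (alternating k) y) : 'I_n.+1 -> N)}.
  move=> k l _ _ /(congr1 (fun h => h ord0)) /(actN_free N_M0) e.
  by rewrite -(glen_alternating k) e glen_alternating.
by rewrite -(card_le_eql (inj_card_eq fI)); exact: subset_card_le.
Qed.

(** Only finitely many solutions lie within [r] of the parameters. Any other one can be replaced,
    without [phi] noticing, by a point in a fresh orbit. *)
Lemma generic_solution m (phi : formula L ('I_1 + 'I_m)) (c : 'I_m -> N) :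
  ~ finite_set (solutions (PFormula phi c)) -> exists a,
  psat (PFormula phi c) a /\ forall i x g, a i <> actN g (c x).
Proof.
move=> inf.
pose w (z : 'I_1 + 'I_m) := match z with inl _ => None | inr x => Some x end.
have [r rP] := sat_local k0 O (ren w phi) (lists_option (@lists_enum 'I_m)).
have [r' r'P] := eqv_extend k0 O r (@lists_enum 'I_m).
pose F := [set (fun=> actN (nth 1 (ball r) (q.1 : 'I_(size (ball r)))) (c q.2)) | q in [set:
    'I_(size (ball r)) * 'I_m]] : set ('I_1 -> N).
have [a0 a0s a0F] : exists2 a, psat (PFormula phi c) a & ~ F a.
  apply: contrapT => no; apply: inf; apply: (@sub_finite_set _ _ F).
    by move=> a sa; apply: contrapT => nF; apply: no; exists a.
  exact/finite_image/finite_finset.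
have far0 g x : near r g -> a0 ord0 <> actN g (c x).
  move=> /ballP gb e; apply: a0F.
  have gi : (index g (ball r) < size (ball r))%N by rewrite index_mem.
  exists (Ordinal gi, x) => //=; apply/funext => i.
  by rewrite nth_index // ord1.
pose u (z : 'I_1 + 'I_m) := cat_val a0 c z.
have [v uv] : exists v : ('I_1 + 'I_m)%type -> M, @same_type N M0 _ u v := to_M0 u.
pose vc x := v (inr x).
have vfar : far r vc (v (inl ord0)).
  move=> x g gr e; apply: (far0 g x gr).
  exact: (uv (feq g (inl ord0) (inr x))).2 e.
have [d dn dE] := (r'P vc vc (conj (fun _ _ _ _ => iff_refl _) (fun _ _ _ _ _ _ _ =>
    iff_refl _))).2 _ vfar.
pose w0 (z : 'I_1 + 'I_m) : M := match z with inl _ => d | inr x => v (inr x) end.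
have [a aP] := @of_M0 'I_1 'I_m c w0 (same_type_comp inr uv).
exists a; split.
  have e1 : sat (M := M0) phi w0.
    have h1 : sat (M := M0) (ren w phi) (fun x => oapp vc (v (inl ord0)) x).
      apply/sat_ren; apply: (eq_iff (congr1 (fun h => sat (M :=
          M0) phi h) _)).1 ((uv phi).1 a0s).
      by apply/funext => -[i|x] //=; rewrite ord1.
    have /sat_ren := (rP _ _ dE).1 h1.
    apply: (eq_iff (congr1 (fun h => sat (M := M0) phi h) _)).1.
    by apply/funext => -[i|x].
  have := (aP phi).2 e1; rewrite /psat /=.
  apply: (eq_iff (congr1 (fun h => sat phi h) _)).1.
  by apply/funext => -[].
move=> i x g e; apply: (dn x).
have /= := (aP (feq g (inl i) (inr x))).1 e => ->.
by [].
Qed.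

Lemma indiscernible_set0 m (A : set N) (b : nat -> 'I_m -> N) :
  indiscernible A b -> indiscernible set0 b.
Proof. by move=> bI k l psi c f g cA; apply: bI => j; case: (cA j). Qed.

Lemma infinite_nondividing (A : set N) (phi : pformula N 1) :
  ~ finite_set (solutions phi) -> ~ divides A phi.
Proof.
case: phi => m phi c inf [b [bI b0 nC]]; apply: nC.
have [a [sa afar]] := generic_solution inf; rewrite /= in b0.
apply: (nondividing N_M0 N_sat N_hom N_fin (indiscernible_set0 bI) (a := a)).
  by rewrite b0.
by move=> i x g; rewrite b0 => /afar.
Qed.

(** Dividing formulas in one variable are algebraic, so a formula covered by finitely many of them
    is algebraic too; this gives [SU]-rank 1. *)
Lemma infinite_nonforking (A : set N) (phi : pformula N 1) :
  ~ finite_set (solutions phi) -> ~ forks A phi.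
Proof.
move=> inf [J [psi [cov div]]]; apply: inf.
apply: (@sub_finite_set _ _ (\bigcup_(i in [set: 'I_J]) solutions (psi i))).
  by move=> a /cov[i ai]; exists i.
apply: bigcup_finite => [|i _]; first exact: finite_finset.
apply: contrapT => inf; exact: infinite_nondividing inf (div i).
Qed.

(** [A] keeps one element of [B] for each coordinate of a realization lying in an orbit of [B]. A
    parameter in the orbit of such a coordinate is a translate of an element of [A], hence constant
    along sequences indiscernible over [A]. *)
Lemma type_nondividing n (B : set N) (p : set (pformula N n)) :
  (B #<= [set: KN])%card -> complete_type B p -> exists A : set N,
  [/\ A `<=` B, (A #<= [set: 'I_n])%card & ~ type_divides A p].
Proof.
move=> BK pB; have [a aP] := N_sat BK pB.
have ex i : exists c, (exists b g, B b /\ a i = actN g b) -> B c /\ exists g, a i = actN g c.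
  have [[b [g [Bb e]]]|no] := pselect (exists b g, B b /\ a i = actN g b).
    by exists b => _; split=> //; exists g.
  by exists (a i).
have [c cP] := choice ex.
pose S := [set i | exists b g, B b /\ a i = actN g b].
exists (c @` S); split.
- by move=> _ [i Si <-]; have [] := cP i Si.
- by apply: card_le_trans (card_image_le _ _) _; exact: subset_card_le.
move=> [[m phi d] phip [b [bI b0 nC]]]; apply: nC; rewrite /= in b0.
have dB x : B (d x) by have [pB1 _ _] := pB; exact: (pB1 _ phip).
apply: (nondividing N_M0 N_sat N_hom N_fin (indiscernible_set0 bI) (a := a)).
  by rewrite b0; exact: (aP _ phip).
move=> i x g; rewrite b0 => e j.
have Si : S i by exists (d x), g.
have [Bc [h ce]] := cP i Si.
have dE : d x = actN (g^-1 * h) (c i).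
  by rewrite (actNM N_M0) -ce e (actNK N_M0).
have [|||_] := bI 1%N 1%N (feq (g^-1 * h) (inl (ord0,
    x)) (inr ord0)) (fun=> c i) (fun=> j) (fun=> 0%N).
- by move=> _; exists i.
- by move=> y z; rewrite !ord1.
- by move=> y z; rewrite !ord1.
by rewrite /= b0 => /(_ dE) ->.
Qed.

(** All points have the same type. The automorphism of the explicit model only serves to compare
    types; homogeneity of [N] gives the one wanted. *)
Lemma conj_act (y : N) (g : Gam) : exists2 s, automorphism s & s y = actN g y.
Proof.
pose u (z : bool) := if z then y else actN g y.
have [v uv] : exists v : bool -> M, @same_type N M0 _ u v := to_M0 u.
have vg : v false = act g (v true) by exact: (uv (feq g false true)).1.
have [t tP] := bounded_fin k0 v.
have [|||s sA sE] := @qfeq_conj K k0 O unit (fun=> v true) (fun=> v false) t.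
- by [].
- by [].
- split=> [_ _ h|_ _ h h' i]; last by rewrite vg; exact: R_diag.
  by rewrite vg; split=> /esym/act_free ->; rewrite act1.
have [||s' s'A s'E] := @tuple_conj N KN unit (fun=> y) (fun=> actN g y) N_hom.
- exact: N_fin.
- move=> phi.
  have h1 : sat phi (fun _ : unit => y) <-> sat (M := M0) phi (fun=> v true) :=
    same_type_comp (fun=> true) uv phi.
  have h2 : sat phi (fun _ : unit => actN g y) <-> sat (M := M0) phi (fun=> v false) :=
    same_type_comp (fun=> false) uv phi.
  have h3 := @sat_auto M0 s unit phi (fun=> v true) (M0_automorphism k0 sA).
  have e : (fun _ : unit => s (v true)) = (fun=> v false) by apply/funext => -[];
      exact: (sE tt).
  have h4 := eq_iff (congr1 (fun h => sat (M := M0) phi h) e).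
  exact: iff_trans h1 (iff_trans h3 (iff_trans h4 (iff_sym h2))).
- by exists s' => //; exact: (s'E tt).
Qed.

(** The varying point is the first argument of [R]: legality of its row along the orbit of [y]
    becomes a covering property at [g = 1] and disjointness at the translates by [gen i]. *)
Definition Rset (y : N) (i : 'I_4) (g : Gam) : set ('I_1 -> N) :=
  solutions (PFormula (frel i 1 (inl ord0) g (inr ord0)) (fun _ : 'I_1 => y)).

Lemma Rset_legal y (a : 'I_1 -> N) :
  (forall i, exists2 k, k != i & Rset y k 1 a) /\
  (forall i j, Rset y i (gen i) a -> Rset y j (gen j) a -> i = j).
Proof.
have [v uv] : exists v : ('I_1 + 'I_1)%type -> M, @same_type N M0 _ (cat_val a (fun _ : 'I_1
    => y)) v := to_M0 _.
have RE i g : Rset y i g a <-> R i (v (inl ord0)) (act g (v (inr ord0))).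
  apply: iff_trans (uv (frel i 1 (inl ord0) g (inr ord0))) _.
  by rewrite -{1}(act1 (v (inl ord0))).
have [l1 l2] := legal_R (v (inl ord0)) (v (inr ord0)); split=> [i|i j /RE h1 /RE h2].
  by have [k ki Rk] := l1 1 i; exists k => //; apply/RE.
by apply: (l2 1); rewrite mulg1.
Qed.

Lemma Rset_image y i g s : automorphism s -> s y = actN g y ->
  [set (fun k => s (a k)) | a in Rset y i 1] = Rset y i g.
Proof.
move=> sA sy.
have key a : Rset y i 1 a <-> Rset y i g (fun k => s (a k)).
  have := sat_auto (frel i 1 (inl ord0) 1 (inr ord0)) (cat_val a (fun _ : 'I_1 => y)) sA.
  suff -> : sat (frel i 1 (inl ord0) 1 (inr ord0)) (fun x => s (cat_val a (fun _ : 'I_1 =>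
      y) x)) =
    Rset y i g (fun k => s (a k)) by [].
  rewrite /Rset /solutions /psat /=; congr (rel_interp _); apply/funext => k.
  by case: ifP => _ //=; exact: etrans (congr1 (actN 1) sy) (actN1 N_M0 _).
have [[s' sK s'K] _ _] := sA.
apply/seteqP; split=> [_ [a Ra <-]|a Ra]; first exact/key.
exists (fun k => s' (a k)); last by apply/funext => k; exact: s'K.
by apply/key; suff -> : (fun k => s (s' (a k))) = a by []; apply/funext => k; exact: s'K.
Qed.

End Consequences.

(** * Measures *)

Section Measure.
Local Open Scope ring_scope.
Variables (K : Type) (k0 : K) (O : regular_order K).
Variables (N : structure L) (KN : Type).
Hypothesis N_M0 : forall chi : sentence L, holds N chi <-> holds (@M0 K k0 O) chi.
Hypothesis N_hom : strongly_homogeneous N KN.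
Hypothesis N_fin : forall (X : finType) (u : X -> N), (range u #<= [set: KN])%card.

Lemma no_invariant_measure (F : realType) (mu : set ('I_1 -> N) -> F) :
  keisler_measure mu -> aut_invariant mu -> False.
Proof.
move=> [mu0 mu1 muU] muA; have [y] := carrier_inhabited N.
pose D psi : set ('I_1 -> N) := solutions (PFormula psi (fun _ : 'I_1 => y)).
(* All sets involved share the single parameter [y], so Boolean operations need no merging of
   parameter lists. *)
pose def A := exists psi, A = D psi.
have defD A : def A -> definable A by move=> [psi ->]; exists (PFormula psi (fun _ : 'I_1 =>
    y)).
have defU A B : def A -> def B -> def (A `|` B).
  move=> [p ->] [q ->]; exists (Imp (Neg p) q).
  apply/seteqP; split=> a; rewrite /D /solutions /psat /=.
    by case=> [pa npa|qa _]; [case: (npa pa)|exact: qa].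
  by move=> h; have [pa|npa] := pselect (sat p (cat_val a (fun=> y))); [left|right; exact: h].
have defB A B : def A -> def B -> def (A `\` B).
  move=> [p ->] [q ->]; exists (Neg (Imp p q)).
  apply/seteqP; split=> a; rewrite /D /solutions /psat /=.
    by move=> [pa nqa] h; exact/nqa/h.
  by move=> h; split; [apply: contrapT => npa; apply: h => /npa|move=> qa; apply: h].
have le_mu A B : def A -> def B -> A `<=` B -> mu A <= mu B.
  move=> dA dB AB; rewrite -(setDUK AB) muU; [|exact: defD|exact/defD/defB|exact: setDIK].
  by rewrite lerDl; apply/mu0/defD/defB.
have mu_subU A B : def A -> def B -> mu (A `|` B) <= mu A + mu B.
  move=> dA dB; have -> : A `|` B = A `|` (B `\` A).
    apply/seteqP; split=> x; last by move=> [xA|[xB _]]; [left|right].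
    by have [xA|nxA] := pselect (A x); [left|move=> []; [left|right]].
  rewrite muU; [|exact: defD|exact/defD/defB|exact: setDIK].
  by rewrite lerD2l; apply: le_mu => //; exact: defB.
pose S i : F := mu (Rset y i 1%g).
have SE i : S i = mu (Rset y i (gen i)).
  have [s sA sy] := conj_act N_M0 N_hom N_fin y (gen i).
  rewrite -(Rset_image N_M0 i sA sy) muA //.
  by apply: defD; eexists.
have dR i g : def (Rset y i g) by eexists.
have triple d a b c : (forall k, k != d -> [\/ k = a, k = b | k = c]) -> 1 <= S a + S b + S c.
  move=> kd; rewrite -mu1.
  have -> : setT = (Rset y a 1%g `|` Rset y b 1%g) `|` Rset y c 1%g.
    apply/seteqP; split=> // x _; have [k nk Rk] := (Rset_legal N_M0 y x).1 d.
    by case: (kd k nk) => e; subst k; [left; left|left; right|right].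
  apply: le_trans (mu_subU _ _ _ _) _; [exact: defU|exact: dR|].
  by rewrite lerD2r; apply: mu_subU.
have disj i j : i != j -> Rset y i (gen i) `&` Rset y j (gen j) = set0.
  move=> ij; apply/seteqP; split=> // x [Ri Rj].
  by rewrite ((Rset_legal N_M0 y x).2 _ _ Ri Rj) eqxx in ij.
pose i0 : 'I_4 := @Ordinal 4 0 isT; pose i1 : 'I_4 := @Ordinal 4 1 isT.
pose i2 : 'I_4 := @Ordinal 4 2 isT; pose i3 : 'I_4 := @Ordinal 4 3 isT.
pose T i := Rset y i (gen i).
have sum_le : S i0 + S i1 + S i2 + S i3 <= 1.
  have dT i : def (T i) by exact: dR.
  rewrite !SE -/(T i0) -/(T i1) -/(T i2) -/(T i3) -muU; [|exact: defD|exact: defD|exact: disj].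
  rewrite -muU; [|by apply: defD; apply: (defU)|exact: defD|by rewrite setIUl !disj // setU0].
  rewrite -muU; [|by apply: defD; do 2?apply: (defU)|exact: defD|by rewrite !setIUl !disj //
      !setU0].
  rewrite -mu1; apply: le_mu => //; first by do 3?apply: (defU).
  by exists (Neg Fal); apply/seteqP; split=> // x _; rewrite /D /solutions /psat /=.
have i4 (k : 'I_4) : [\/ k = i0, k = i1, k = i2 | k = i3].
  by case: k => [[|[|[|[|//]]]] kk]; [constructor 1|constructor 2|constructor 3|constructor
      4]; exact: val_inj.
have cover d a b c : (forall k, [\/ k = d, k = a, k = b | k = c]) ->
    1 <= S a + S b + S c.
  move=> h; apply: (triple d) => k; case: (h k) => ->; rewrite ?eqxx //.
  - by constructor 1.
  - by constructor 2.
  - by constructor 3.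
have c0 : 1 <= S i1 + S i2 + S i3 by apply: (cover i0); exact: i4.
have c1 : 1 <= S i0 + S i2 + S i3.
  by apply: (cover i1) => k; case: (i4 k) => ->; [constructor 2|constructor 1|constructor
      3|constructor 4].
have c2 : 1 <= S i0 + S i1 + S i3.
  by apply: (cover i2) => k; case: (i4 k) => ->; [constructor 2|constructor 3|constructor
      1|constructor 4].
have c3 : 1 <= S i0 + S i1 + S i2.
  by apply: (cover i3) => k; case: (i4 k) => ->; [constructor 2|constructor 3|constructor
      4|constructor 1].
lra.
Qed.

End Measure.

Definition K0 : Type := K_of (formula L nat).

Lemma card_le_fin (X : finType) (T : Type) (u : X -> T) :
  (range u #<= [set: formula L nat])%card.
Proof.
apply: card_le_trans (card_image_le _ _) _.
apply/(card_le_injP (Fal : formula L nat)).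
(* The equations between variable [k] and variable 0 are pairwise different formulas, so finite sets
   are small. *)
exists (fun x => Eq (Var (enum_rank x : nat)) (Var 0%N)) => x z _ _ [].
by move=> /ord_inj/enum_rank_inj.
Qed.

Lemma card_formula_K0 : ([set: set (formula L nat)] #<= [set: K0])%card.
Proof.
apply/(card_le_injP ((fun=> set0) : K0)); exists (fun A _ => A) => A B _ _.
by move=> /(congr1 (fun h => h 0%N)).
Qed.

Lemma card_formula_set : ([set: formula L nat] #<= [set: set (formula L nat)])%card.
Proof.
apply/(card_le_injP (set0 : set (formula L nat))); exists set1 => x z _ _ e.
by have : [set z] x by rewrite -e.
Qed.

Local Close Scope group_scope.
Local Open Scope ring_scope.

Theorem theorem1p5 (R : realType) :
  exists (L : language) (T : theory L),
    [/\ complete_theory T, simple_theory T, SU_rank_one T,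
        inhabited (monster T)
      & exists (n m : nat) (phi : formula L ('I_n + 'I_m)),
          forall Mbar : monster T, exists b : 'I_m -> Mbar,
            ~ forks set0 (PFormula phi b) /\
            (forall mu : set ('I_n -> Mbar) -> R,
               keisler_measure mu -> aut_invariant mu ->
               mu (solutions (PFormula phi b)) = 0)].
Proof.
pose k0 : K0 := fun=> set0.
have [O] := @regular_order_K (formula L nat) Fal.
pose U := M0 k0 O; pose T : theory L := [set chi | holds U chi].
have T_U (Mbar : monster T) chi : holds Mbar chi <-> holds U chi.
  split=> [h|h]; last exact: (@mon_models _ _ Mbar).
  apply: contrapT => nh; have := @mon_models _ _ Mbar (Neg chi) nh; exact.
have T_sat (Mbar : monster T) := @mon_saturated _ _ Mbar.
have T_hom (Mbar : monster T) := @mon_homogeneous _ _ Mbar.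
have T_fin (Mbar : monster T) (X : finType) (u : X ->
    Mbar) : (range u #<= [set: mon_card Mbar])%card.
  apply: card_le_trans (mon_large Mbar); apply: card_le_trans card_formula_set.
  exact: card_le_fin.
exists L, T; split.
- split=> [|chi]; first by exists U.
  have [h|nh] := pselect (holds U chi); first by left=> N NT; exact: NT.
  by right=> N NT; exact: (NT (Neg chi)).
- move=> Mbar n B p BK pB.
  have [A [AB An nA]] := type_nondividing (T_U Mbar) (T_sat Mbar) (T_hom Mbar) (T_fin Mbar)
      BK pB.
  exists A; split=> //; apply: card_le_trans An _.
  have -> : [set: 'I_n] = range (@id 'I_n) by apply/seteqP; split=> // i _; exists i.
  exact: card_le_fin.
- move=> Mbar A B p q _ _ _ [_ _ _] _ _ [phi qphi phiF]; exists phi => //.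
  apply: contrapT => inf.
  exact: (infinite_nonforking (T_U Mbar) (T_sat Mbar) (T_hom Mbar) (T_fin Mbar)) inf phiF.
- constructor; apply: (@Monster L T U K0).
  + by move=> chi.
  + exact: card_formula_K0.
  + exact: M0_saturated.
  + exact: M0_homogeneous.
- exists 1%N, 0%N, (Neg Fal) => Mbar.
  exists (fun k : 'I_0 => False_rect _ (notF (ltn_ord k))); split.
    apply: (infinite_nonforking (T_U Mbar) (T_sat Mbar) (T_hom Mbar) (T_fin Mbar)).
    move=> fin; apply: (infinite_domain (T_U Mbar) (n := 0)).
    by apply: sub_finite_set fin => a _; rewrite /solutions /psat /=.
  move=> mu muK muA; exfalso.
  exact: (no_invariant_measure (T_U Mbar) (T_hom Mbar) (T_fin Mbar) muK muA).
Qed.
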